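(* Let $k$ be a real number with $0<k^2<1$. If the series below converges, then $$\sum_{n=0}^{\infty} (-1)^n (2n+1)^3\,\operatorname{csch}^2\!\left(\frac{2n+1}{2}\,\frac{K'}{K}\,\pi\right) = \frac{8(k^2-1)K^4\left(3E+(k^2-3)K\right)}{\pi^4\left(K'(E-K)+E'K\right)}.$$
   Context: For the elliptic modulus $k$ (with $0<k^2<1$), write $k'=\sqrt{1-k^2}$. The complete elliptic integrals of the first and second kind are $K=K(k)=\int_0^{\pi/2}\frac{d\theta}{\sqrt{1-k^2\sin^2\theta}}$ and $E=E(k)=\int_0^{\pi/2}\sqrt{1-k^2\sin^2\theta}\,d\theta$; also $K'=K(k')$ and $E'=E(k')$. Here $\operatorname{csch} x = 1/\sinh x$. *)

(* Defs.v *)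
From Stdlib Require Import Reals.
From Coquelicot Require Import Coquelicot.
Open Scope R_scope.

(* The argument of [ellK] and [ellE] is the modulus k, not the parameter
   m = k^2. *)
Definition ellK (k : R) : R :=
  RInt (fun theta => 1 / sqrt (1 - k ^ 2 * sin theta ^ 2)) 0 (PI / 2).

Definition ellE (k : R) : R :=
  RInt (fun theta => sqrt (1 - k ^ 2 * sin theta ^ 2)) 0 (PI / 2).

Definition compl_modulus (k : R) : R := sqrt (1 - k ^ 2).

Definition csch (x : R) : R := 1 / sinh x.

(* Main.v *)
Require Import Defs.
From Stdlib Require Import Reals ZArith Lia Lra Psatz.
From Coquelicot Require Import Coquelicot.
Open Scope R_scope.

(** The identity is the derivative, with respect to the modulus, of a simpler
    one.  Write m = k^2 and y = PI K'/K, so that the nome is q = exp (-y).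
    Differentiating term by term, the series of the theorem is dF/dy for the
    Lambert series
      F(y) = 1 - 4 sum_n (-1)^n (2n+1)^2 / (exp ((2n+1) y) - 1),
    and F(y) = (2K/PI)^3 (1 - m) ([lambert_series_elliptic]; classically
    F = theta_3^2 theta_4^4).  With
      dK/dm = (E - (1-m) K) / (2m (1-m))  and
      dy/dm = - PI W / (2m (1-m) K^2),  W = K'(E - K) + E'K > 0,
    the chain rule gives the formula, whose denominator is W.

    To evaluate F, expand 2 sech^3 - sech = - sech'' in powers of exp (-x) and
    exchange the two summations: F(y) is the sum of 2 sech^3 - sech over the
    points j y, j in Z ([lambert_series_theta]).  Put
      a = sum_j sech (j y),  c = sum_j sech ((j + 1/2) y).
    These are theta_3^2 and theta_2^2.  Products of such sums are arranged by
    diagonals: the partial fraction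
      sech u sech v = (tanh u - tanh v) / sinh (u - v)
    makes each diagonal telescope, so the square of t |-> sum_j sech (t + j y)
    differs from the sum of the squares by a constant ([lattice_sum_square]).
    Two consequences follow.
    - Splitting Z into even and odd integers, (a, c) at y is obtained from
      (a, c) at 2y by a step of the arithmetic-geometric mean:
      a(y) = a(2y) + c(2y) and c(y)^2 = 4 a(2y) c(2y).
    - A similar evaluation of the product of the sum of sech by the sum of
      sech^2 gives F = a (a^2 - c^2) ([lattice_sum_cubic]).

    Finally the elliptic integrals enter through Gauss's transformation
    I(a, b) = I((a+b)/2, sqrt (ab)) of
    I(a, b) = int_0^{PI/2} dx / sqrt (a^2 cos^2 x + b^2 sin^2 x).  With
    b^2 = a^2 - c^2, the quantities I(a, b) and I(a, c)/y are unchanged when y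
    is doubled, hence equal to their limits PI/2 and 1/2 at infinity
    ([gauss_int_theta_ab], [gauss_int_theta_ac]).  For the modulus c/a this
    reads K = a PI/2 and K' = a y/2, so that y = PI K'/K; since K'/K is strictly
    monotone in the modulus, c/a is the given k, whence a = 2K/PI and
    a^2 - c^2 = a^2 (1 - m). *)

(** * Double series of real numbers *)

Lemma series_plus (a b : nat -> R) (la lb : R) :
  is_series a la -> is_series b lb -> is_series (fun n => a n + b n) (la + lb).
Proof. intros Ha Hb; exact (is_series_plus a b la lb Ha Hb). Qed.

Lemma series_scal (c : R) (a : nat -> R) (l : R) :
  is_series a l -> is_series (fun n => c * a n) (c * l).
Proof. intros H; exact (is_series_scal c a l H). Qed.

Lemma series_decr_1 (a : nat -> R) (l : R) :
  is_series (fun n => a (S n)) l -> is_series a (a 0%nat + l).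
Proof.
  intros H; apply (is_series_decr_1 a).
  replace (plus _ _) with l; [exact H|].
  change (l = a 0%nat + l + - a 0%nat); ring.
Qed.

Lemma series_incr_1 (a : nat -> R) (l : R) :
  is_series a l -> is_series (fun n => a (S n)) (l - a 0%nat).
Proof.
  intros H; apply (is_series_incr_1 a).
  replace (plus _ _) with l; [exact H|].
  change (l = l - a 0%nat + a 0%nat); ring.
Qed.

Lemma sum_n_nonneg (a : nat -> R) n : (forall k, 0 <= a k) -> 0 <= sum_n a n.
Proof.
  intros H; induction n as [|n IH]; [rewrite sum_O; auto|].
  rewrite sum_Sn; change plus with Rplus; specialize (H (S n)); lra.
Qed.

Lemma sum_n_le_sum (a : nat -> R) l n :
  (forall k, 0 <= a k) -> is_series a l -> sum_n a n <= l.
Proof.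
  intros Ha Hl.
  apply (is_lim_seq_incr_compare (sum_n a)).
  - exact Hl.
  - intros k; rewrite sum_Sn; change plus with Rplus; specialize (Ha (S k)); lra.
Qed.

Lemma series_nonneg (a : nat -> R) l :
  (forall n, 0 <= a n) -> is_series a l -> 0 <= l.
Proof.
  intros Ha Hl. apply Rle_trans with (sum_n a 0).
  - rewrite sum_O; auto.
  - now apply sum_n_le_sum.
Qed.

Lemma series_le (a b : nat -> R) la lb :
  (forall n, a n <= b n) -> is_series a la -> is_series b lb -> la <= lb.
Proof.
  intros H Ha Hb.
  apply (is_lim_seq_le (sum_n a) (sum_n b) la lb); auto.
  intros n; apply sum_n_m_le; auto.
Qed.

Lemma ex_series_dominated (a b : nat -> R) :
  (forall n, Rabs (a n) <= b n) -> ex_series b -> ex_series a.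
Proof. intros H; apply (ex_series_le a b); exact H. Qed.

Lemma series_sum_n (u : nat -> nat -> R) (c : nat -> R) J :
  (forall j, is_series (fun i => u i j) (c j)) ->
  is_series (fun i => sum_n (u i) J) (sum_n c J).
Proof.
  intros H; induction J as [|J IH].
  - rewrite sum_O. apply is_series_ext with (2 := H 0%nat).
    intros i; now rewrite sum_O.
  - rewrite sum_Sn. eapply is_series_ext; [|apply series_plus; [exact IH|apply H]].
    intros i; now rewrite sum_Sn.
Qed.

(** Each column of a nonnegative array is dominated by the row sums, and any
    finite set of columns adds up to at most the total of the rows.  Applied to
    the array and to its transpose, this gives both inequalities of
    [tonelli]. *)
Lemma sum_columns_le (u : nat -> nat -> R) (r c : nat -> R) (S : R) J :
  (forall i j, 0 <= u i j) ->
  (forall i, is_series (u i) (r i)) ->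
  (forall j, is_series (fun i => u i j) (c j)) ->
  is_series r S -> sum_n c J <= S.
Proof.
  intros Hu Hr Hc HS.
  apply (series_le (fun i => sum_n (u i) J) r); auto.
  - intros i; apply sum_n_le_sum; auto.
  - now apply series_sum_n.
Qed.

Lemma tonelli (u : nat -> nat -> R) (r : nat -> R) (S : R) :
  (forall i j, 0 <= u i j) ->
  (forall i, is_series (u i) (r i)) -> is_series r S ->
  exists c : nat -> R, (forall j, is_series (fun i => u i j) (c j)) /\ is_series c S.
Proof.
  intros Hu Hr HS.
  assert (Hc : forall j, is_series (fun i => u i j) (Series (fun i => u i j))).
  { intros j; apply Series_correct.
    apply ex_series_dominated with r; [|now exists S].
    intros i; rewrite Rabs_pos_eq by auto.
    apply Rle_trans with (sum_n (u i) j); [|apply sum_n_le_sum; auto].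
    destruct j as [|j]; [rewrite sum_O; lra|].
    rewrite sum_Sn; change plus with Rplus.
    pose proof (sum_n_nonneg (u i) j (Hu i)); lra. }
  set (c := fun j => Series (fun i => u i j)) in *.
  exists c; split; [exact Hc|].
  assert (Hc0 : forall j, 0 <= c j).
  { intros j. apply series_nonneg with (fun i => u i j); auto. }
  assert (Hle : forall J, sum_n c J <= S).
  { intros J; now apply (sum_columns_le u r c S). }
  destruct (ex_finite_lim_seq_incr (sum_n c) S) as [S' HS']; auto.
  { intros n; rewrite sum_Sn; change plus with Rplus; specialize (Hc0 (Datatypes.S n)); lra. }
  assert (HS'' : is_series c S') by exact HS'.
  replace S with S'; [exact HS''|].
  apply Rle_antisym.
  - apply (is_lim_seq_le (sum_n c) (fun _ => S) S' S); auto.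
    apply is_lim_seq_const.
  - apply (is_lim_seq_le (sum_n r) (fun _ => S') S S'); auto.
    + intros n; apply (sum_columns_le (fun j i => u i j) c r S'); auto.
    + apply is_lim_seq_const.
Qed.

(** Absolute convergence reduces this to [tonelli] for |u| and |u| + u. *)
Lemma fubini (u : nat -> nat -> R) (r R1 : nat -> R) (S : R) :
  (forall i, is_series (fun j => Rabs (u i j)) (R1 i)) -> ex_series R1 ->
  (forall i, is_series (u i) (r i)) -> is_series r S ->
  exists c : nat -> R, (forall j, is_series (fun i => u i j) (c j)) /\ is_series c S.
Proof.
  intros HR1 [S1 HS1] Hr HS.
  destruct (tonelli (fun i j => Rabs (u i j)) R1 S1) as [c1 [Hc1 Hs1]]; auto.
  { intros; apply Rabs_pos. }
  destruct (tonelli (fun i j => Rabs (u i j) + u i j) (fun i => R1 i + r i) (S1 + S))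
    as [c2 [Hc2 Hs2]].
  { intros i j; generalize (Rle_abs (- u i j)); rewrite Rabs_Ropp; lra. }
  { intros i; now apply series_plus. }
  { now apply series_plus. }
  exists (fun j => c2 j + -1 * c1 j); split.
  - intros j; eapply is_series_ext; [|apply series_plus;
      [apply Hc2|apply series_scal, Hc1]].
    intros i; simpl; ring.
  - replace S with (S1 + S + -1 * S1) by ring.
    apply series_plus; auto. now apply series_scal.
Qed.

(** * Sums over the integers *)

(** The two half-series are required to converge separately, which excludes
    symmetric summation and makes the sum invariant under shifts. *)
Definition is_zsum (f : Z -> R) (l : R) : Prop :=
  exists l1 l2, is_series (fun n => f (Z.of_nat n)) l1 /\
    is_series (fun n => f (- Z.of_nat n - 1)%Z) l2 /\ l = l1 + l2.

Definition zsum (f : Z -> R) : R :=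
  Series (fun n => f (Z.of_nat n)) + Series (fun n => f (- Z.of_nat n - 1)%Z).

Definition ex_zsum (f : Z -> R) : Prop := exists l, is_zsum f l.

Lemma is_zsum_unique f l : is_zsum f l -> zsum f = l.
Proof.
  intros [l1 [l2 [H1 [H2 ->]]]]; unfold zsum.
  now rewrite (is_series_unique _ _ H1), (is_series_unique _ _ H2).
Qed.

Lemma zsum_correct f : ex_zsum f -> is_zsum f (zsum f).
Proof. intros [l H]; now rewrite (is_zsum_unique f l H). Qed.

Lemma is_zsum_eq f l l' : is_zsum f l -> is_zsum f l' -> l = l'.
Proof. intros H H'; now rewrite <- (is_zsum_unique _ _ H), <- (is_zsum_unique _ _ H'). Qed.

Lemma is_zsum_ext f g l : (forall m, f m = g m) -> is_zsum f l -> is_zsum g l.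
Proof.
  intros H [l1 [l2 [H1 [H2 ->]]]]; exists l1, l2; repeat split.
  - apply is_series_ext with (2 := H1); auto.
  - apply is_series_ext with (2 := H2); auto.
Qed.

Lemma is_zsum_plus f g l k :
  is_zsum f l -> is_zsum g k -> is_zsum (fun m => f m + g m) (l + k).
Proof.
  intros [l1 [l2 [H1 [H2 ->]]]] [k1 [k2 [K1 [K2 ->]]]].
  exists (l1 + k1), (l2 + k2); repeat split; [| |ring].
  - exact (series_plus _ _ _ _ H1 K1).
  - exact (series_plus _ _ _ _ H2 K2).
Qed.

Lemma is_zsum_scal c f l : is_zsum f l -> is_zsum (fun m => c * f m) (c * l).
Proof.
  intros [l1 [l2 [H1 [H2 ->]]]].
  exists (c * l1), (c * l2); repeat split; [| |ring].
  - exact (series_scal c _ _ H1).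
  - exact (series_scal c _ _ H2).
Qed.

Lemma is_zsum_minus f g l k :
  is_zsum f l -> is_zsum g k -> is_zsum (fun m => f m - g m) (l - k).
Proof.
  intros Hf Hg. replace (l - k) with (l + -1 * k) by ring.
  apply is_zsum_ext with (fun m => f m + -1 * g m); [intros; ring|].
  apply is_zsum_plus; auto. now apply is_zsum_scal.
Qed.

Lemma is_zsum_single x : is_zsum (fun m => if Z.eq_dec m 0 then x else 0) x.
Proof.
  assert (H0 : is_series (fun _ : nat => 0) 0).
  { assert (Hq : Rabs (1 / 2) < 1) by (rewrite Rabs_pos_eq; lra).
    pose proof (series_scal 0 _ _ (is_series_geom _ Hq)) as H.
    rewrite Rmult_0_l in H. apply is_series_ext with (2 := H).
    intros n; exact (Rmult_0_l _). }
  exists x, 0; repeat split; [| |ring].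
  - assert (H1 : is_series (fun n => if Z.eq_dec (Z.of_nat (S n)) 0 then x else 0) 0).
    { apply is_series_ext with (2 := H0). intros n.
      destruct (Z.eq_dec _ _); [lia|reflexivity]. }
    apply (series_decr_1 (fun n => if Z.eq_dec (Z.of_nat n) 0 then x else 0)) in H1.
    simpl in H1; now rewrite Rplus_0_r in H1.
  - apply is_series_ext with (2 := H0). intros n.
    destruct (Z.eq_dec _ _); [lia|reflexivity].
Qed.

Lemma is_zsum_succ f l : is_zsum f l -> is_zsum (fun m => f (m + 1)%Z) l.
Proof.
  intros [l1 [l2 [H1 [H2 ->]]]].
  exists (l1 - f 0%Z), (f 0%Z + l2); repeat split; [| |ring].
  - apply is_series_ext with (2 := series_incr_1 _ _ H1).
    intros n; simpl; f_equal; lia.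
  - apply (series_decr_1 (fun n => f (- Z.of_nat n - 1 + 1)%Z)).
    apply is_series_ext with (2 := H2). intros n; f_equal; lia.
Qed.

Lemma is_zsum_reflect1 f l : is_zsum f l -> is_zsum (fun m => f (- m - 1)%Z) l.
Proof.
  intros [l1 [l2 [H1 [H2 ->]]]]. exists l2, l1; repeat split; [exact H2| |ring].
  apply is_series_ext with (2 := H1). intros n; f_equal; lia.
Qed.

Lemma is_zsum_opp f l : is_zsum f l -> is_zsum (fun m => f (- m)%Z) l.
Proof.
  intros H. apply is_zsum_succ, is_zsum_reflect1 in H.
  apply is_zsum_ext with (2 := H). intros m; f_equal; lia.
Qed.

Lemma is_zsum_shift f l d : is_zsum f l -> is_zsum (fun m => f (m + d)%Z) l.
Proof.
  revert f; assert (Hn : forall (n : nat) f, is_zsum f l -> is_zsum (fun m => f (m + Z.of_nat n)%Z) l).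
  { induction n as [|n IH]; intros f H.
    - apply is_zsum_ext with (2 := H); intros m; f_equal; lia.
    - apply IH, is_zsum_succ in H.
      apply is_zsum_ext with (2 := H); intros m; f_equal; lia. }
  intros f H. destruct (Z_le_gt_dec 0 d) as [Hd|Hd].
  - rewrite <- (Z2Nat.id d Hd). now apply Hn.
  - apply is_zsum_opp in H. apply (Hn (Z.to_nat (- d))) in H.
    apply is_zsum_opp in H. apply is_zsum_ext with (2 := H).
    intros m; simpl; f_equal; lia.
Qed.

Lemma ex_zsum_dominated f g :
  (forall m, Rabs (f m) <= g m) -> ex_zsum g -> ex_zsum f.
Proof.
  intros H [l [l1 [l2 [H1 [H2 _]]]]].
  destruct (ex_series_dominated (fun n => f (Z.of_nat n)) (fun n => g (Z.of_nat n))) as [k1 K1];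
    [auto|now exists l1|].
  destruct (ex_series_dominated (fun n => f (- Z.of_nat n - 1)%Z)
    (fun n => g (- Z.of_nat n - 1)%Z)) as [k2 K2]; [auto|now exists l2|].
  exists (k1 + k2), k1, k2; auto.
Qed.

Lemma is_zsum_le f g l k :
  (forall m, f m <= g m) -> is_zsum f l -> is_zsum g k -> l <= k.
Proof.
  intros H [l1 [l2 [H1 [H2 ->]]]] [k1 [k2 [K1 [K2 ->]]]].
  apply Rplus_le_compat; eapply series_le; eauto; simpl; auto.
Qed.

Lemma series_even_odd (a : nat -> R) l1 l2 :
  is_series (fun n => a (2 * n)%nat) l1 ->
  is_series (fun n => a (S (2 * n))) l2 -> is_series a (l1 + l2).
Proof.
  intros H1 H2.
  assert (Ho : forall n, sum_n a (S (2 * n)) =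
     sum_n (fun n => a (2 * n)%nat) n + sum_n (fun n => a (S (2 * n))) n).
  { induction n as [|n IH].
    - rewrite Nat.mul_0_r, sum_Sn, !sum_O; reflexivity.
    - replace (S (2 * S n)) with (S (S (S (2 * n)))) by lia.
      rewrite sum_Sn, sum_Sn, IH, !sum_Sn.
      replace (2 * S n)%nat with (S (S (2 * n))) by lia.
      change plus with Rplus; simpl; ring. }
  assert (HL : is_lim_seq (fun n => sum_n a (S (2 * n))) (l1 + l2)).
  { apply is_lim_seq_ext with (1 := fun n => eq_sym (Ho n)).
    now apply is_lim_seq_plus'. }
  assert (HL2 : is_lim_seq (fun n => sum_n a (2 * n)%nat) (l1 + l2)).
  { replace (l1 + l2) with (l1 + l2 - 0) by ring.
    apply is_lim_seq_ext with (fun n => sum_n a (S (2 * n)) - a (S (2 * n))).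
    { intros n; rewrite sum_Sn; change plus with Rplus; ring. }
    apply is_lim_seq_minus'; auto.
    apply (ex_series_lim_0 (fun n => a (S (2 * n)))). now exists l2. }
  unfold is_series.
  apply is_lim_seq_spec in HL; apply is_lim_seq_spec in HL2.
  change (is_lim_seq (sum_n a) (l1 + l2)). apply is_lim_seq_spec.
  intros eps. destruct (HL eps) as [N1 HN1]. destruct (HL2 eps) as [N2 HN2].
  exists (S (2 * (N1 + N2))). intros n Hn.
  destruct (Nat.Even_or_Odd n) as [[k ->]|[k ->]].
  - apply HN2; lia.
  - rewrite Nat.add_1_r; apply HN1; lia.
Qed.

Lemma is_zsum_even_odd f l1 l2 :
  is_zsum (fun m => f (2 * m)%Z) l1 -> is_zsum (fun m => f (2 * m + 1)%Z) l2 ->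
  is_zsum f (l1 + l2).
Proof.
  intros [a1 [a2 [A1 [A2 ->]]]] [b1 [b2 [B1 [B2 ->]]]].
  exists (a1 + b1), (b2 + a2); repeat split; [| |ring]; apply series_even_odd.
  - apply is_series_ext with (2 := A1); intros n; f_equal; lia.
  - apply is_series_ext with (2 := B1); intros n; f_equal; lia.
  - apply is_series_ext with (2 := B2); intros n; f_equal; lia.
  - apply is_series_ext with (2 := A2); intros n; f_equal; lia.
Qed.

(** The plane splits into four quadrants, on each of which [tonelli] applies. *)
Lemma tonelli_Z (u : Z -> Z -> R) (r : Z -> R) (S : R) :
  (forall i j, 0 <= u i j) ->
  (forall i, is_zsum (u i) (r i)) -> is_zsum r S ->
  exists c : Z -> R, (forall j, is_zsum (fun i => u i j) (c j)) /\ is_zsum c S.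
Proof.
  intros Hu Hr [S1 [S2 [HS1 [HS2 ->]]]].
  set (p := fun n => Z.of_nat n). set (q := fun n => (- Z.of_nat n - 1)%Z).
  (* The rows with nonnegative index, then those with negative index. *)
  assert (half : forall (e : nat -> Z) (T : R), is_series (fun n => r (e n)) T ->
    exists (c : Z -> R) (T1 T2 : R), (forall j, is_series (fun n => u (e n) j) (c j)) /\
     is_series (fun n => c (p n)) T1 /\ is_series (fun n => c (q n)) T2 /\ T = T1 + T2).
  { intros e T HT.
    assert (quarter : forall s : nat -> Z, (forall i, ex_series (fun n => u i (s n))) ->
       (forall i, Series (fun n => u i (s n)) <= r i) ->
       exists T1, is_series (fun n => Series (fun k => u (e n) (s k))) T1 /\
        exists c : nat -> R, (forall j, is_series (fun n => u (e n) (s j)) (c j)) /\ is_series c T1).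
    { intros s Hs Hsr.
      assert (He : ex_series (fun n => Series (fun k => u (e n) (s k)))).
      { apply ex_series_dominated with (fun n => r (e n)); [|now exists T].
        intros n; rewrite Rabs_pos_eq; [apply Hsr|].
        apply series_nonneg with (fun k => u (e n) (s k)); auto.
        now apply Series_correct. }
      destruct He as [T1 HT1]; exists T1; split; [exact HT1|].
      apply (tonelli (fun n k => u (e n) (s k)) (fun n => Series (fun k => u (e n) (s k))) T1); auto.
      intros n; now apply Series_correct. }
    assert (Hpq : forall i, ex_series (fun n => u i (p n)) /\ ex_series (fun n => u i (q n)) /\
      r i = Series (fun n => u i (p n)) + Series (fun n => u i (q n)) /\
      0 <= Series (fun n => u i (p n)) /\ 0 <= Series (fun n => u i (q n))).
    { intros i. rewrite <- (is_zsum_unique _ _ (Hr i)).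
      destruct (Hr i) as [l1 [l2 [H1 [H2 _]]]].
      split; [now exists l1|split; [now exists l2|split; [reflexivity|]]].
      unfold p, q; rewrite (is_series_unique _ _ H1), (is_series_unique _ _ H2).
      split; [apply series_nonneg with (2 := H1)|apply series_nonneg with (2 := H2)]; auto. }
    destruct (quarter p) as [T1 [HT1 [c1 [Hc1 Hc1s]]]];
      [apply Hpq|intros i; destruct (Hpq i) as [? [? [? [? ?]]]]; lra|].
    destruct (quarter q) as [T2 [HT2 [c2 [Hc2 Hc2s]]]];
      [apply Hpq|intros i; destruct (Hpq i) as [? [? [? [? ?]]]]; lra|].
    exists (fun j => Series (fun n => u (e n) j)), T1, T2.
    assert (E1 : forall n, c1 n = Series (fun k => u (e k) (p n))).
    { intros n; symmetry; now apply is_series_unique. }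
    assert (E2 : forall n, c2 n = Series (fun k => u (e k) (q n))).
    { intros n; symmetry; now apply is_series_unique. }
    repeat split.
    - intros j. apply Series_correct.
      destruct (Z_le_gt_dec 0 j) as [Hj|Hj].
      + assert (E : j = p (Z.to_nat j)) by (unfold p; lia).
        rewrite E; eexists; apply Hc1.
      + assert (E : j = q (Z.to_nat (- j - 1))) by (unfold q; lia).
        rewrite E; eexists; apply Hc2.
    - now apply is_series_ext with (1 := E1).
    - now apply is_series_ext with (1 := E2).
    - rewrite <- (is_series_unique _ _ HT). apply is_series_unique.
      apply is_series_ext with (fun n => Series (fun k => u (e n) (p k)) + Series (fun k => u (e n) (q k))).
      { intros n; symmetry; apply Hpq. }
      now apply series_plus. }
  destruct (half p S1 HS1) as [c1 [T1 [T2 [Hc1 [K1 [K2 ->]]]]]].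
  destruct (half q S2 HS2) as [c2 [U1 [U2 [Hc2 [L1 [L2 ->]]]]]].
  exists (fun j => c1 j + c2 j); split.
  - intros j; exists (c1 j), (c2 j); repeat split; [apply Hc1|apply Hc2].
  - exists (T1 + U1), (T2 + U2); repeat split; [| |ring].
    + exact (series_plus _ _ _ _ K1 L1).
    + exact (series_plus _ _ _ _ K2 L2).
Qed.

(** * Hyperbolic functions *)

Definition sech (x : R) : R := / cosh x.

Lemma cosh_pos x : 0 < cosh x.
Proof. unfold cosh; generalize (exp_pos x) (exp_pos (- x)); lra. Qed.

Lemma cosh_opp x : cosh (- x) = cosh x.
Proof. unfold cosh; rewrite Ropp_involutive; lra. Qed.

Lemma cosh_sq x : cosh x ^ 2 = 1 + sinh x ^ 2.
Proof.
  unfold cosh, sinh; rewrite exp_Ropp; field.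
  generalize (exp_pos x); lra.
Qed.

Lemma cosh_ge_1 x : 1 <= cosh x.
Proof. generalize (cosh_sq x) (cosh_pos x) (pow2_ge_0 (sinh x)); nra. Qed.

Lemma sinh_pos x : 0 < x -> 0 < sinh x.
Proof. intros H; rewrite <- sinh_0; now apply sinh_lt. Qed.

Lemma sinh_neq_0 x : x <> 0 -> sinh x <> 0.
Proof.
  intros H E. destruct (Rdichotomy _ _ H) as [K|K]; apply sinh_lt in K;
    rewrite sinh_0 in K; lra.
Qed.

Lemma sinh_minus u v : sinh (u - v) = sinh u * cosh v - cosh u * sinh v.
Proof.
  unfold cosh, sinh. replace (- (u - v)) with (- u + v) by ring.
  unfold Rminus; rewrite !exp_plus. field.
Qed.

Lemma sech_pos x : 0 < sech x.
Proof. apply Rinv_0_lt_compat, cosh_pos. Qed.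

Lemma sech_opp x : sech (- x) = sech x.
Proof. unfold sech; now rewrite cosh_opp. Qed.

Lemma sech_le_1 x : sech x <= 1.
Proof.
  unfold sech; rewrite <- Rinv_1. apply Rinv_le_contravar; [lra|apply cosh_ge_1].
Qed.

Lemma sech_0 : sech 0 = 1.
Proof. unfold sech; rewrite cosh_0; lra. Qed.

Lemma sech_le_exp x : sech x <= 2 * exp (- x).
Proof.
  rewrite exp_Ropp. replace (2 * / exp x) with (/ (exp x / 2)).
  2:{ field; generalize (exp_pos x); lra. }
  apply Rinv_le_contravar; unfold cosh; generalize (exp_pos x) (exp_pos (- x)); lra.
Qed.

Lemma sech_ge_exp x : 0 <= x -> exp (- x) <= sech x.
Proof.
  intros H; rewrite exp_Ropp. apply Rinv_le_contravar; [apply cosh_pos|].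
  unfold cosh. assert (exp (- x) <= exp x); [|lra].
  destruct (Req_dec x 0) as [->|]; [rewrite Ropp_0; lra|].
  apply Rlt_le, exp_increasing; lra.
Qed.

Lemma exp_mult_INR x n : exp (INR n * x) = exp x ^ n.
Proof.
  induction n as [|n IH].
  - simpl; rewrite Rmult_0_l; apply exp_0.
  - rewrite S_INR, Rmult_plus_distr_r, Rmult_1_l, exp_plus, IH; simpl; ring.
Qed.

Lemma exp_neg_lt_1 y : 0 < y -> exp (- y) < 1.
Proof. intros; rewrite <- exp_0; apply exp_increasing; lra. Qed.

Lemma sech_progression_le c y n : sech (c + INR n * y) <= 2 * exp (- c) * exp (- y) ^ n.
Proof.
  eapply Rle_trans; [apply sech_le_exp|].
  rewrite <- exp_mult_INR.
  replace (- (c + INR n * y)) with (- c + INR n * - y) by ring.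
  rewrite exp_plus; lra.
Qed.

Lemma series_geom_exp y c : 0 < y ->
  is_series (fun n => c * exp (- y) ^ n) (c * / (1 - exp (- y))).
Proof.
  intros Hy. apply series_scal, is_series_geom.
  rewrite Rabs_pos_eq; [now apply exp_neg_lt_1|apply Rlt_le, exp_pos].
Qed.

Lemma series_sech c y : 0 < y ->
  exists l, is_series (fun n => sech (c + INR n * y)) l /\
    0 <= l <= 2 * exp (- c) / (1 - exp (- y)).
Proof.
  intros Hy.
  assert (He : ex_series (fun n => sech (c + INR n * y))).
  { apply ex_series_dominated with (fun n => 2 * exp (- c) * exp (- y) ^ n).
    - intros n; rewrite Rabs_pos_eq; [apply sech_progression_le|apply Rlt_le, sech_pos].
    - eexists; now apply series_geom_exp. }
  destruct He as [l Hl]; exists l; split; [exact Hl|split].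
  - apply series_nonneg with (2 := Hl); intros; apply Rlt_le, sech_pos.
  - apply series_le with (2 := Hl) (3 := series_geom_exp y (2 * exp (- c)) Hy).
    intros n; apply sech_progression_le.
Qed.

(** * Sums of sech over a lattice *)

Definition lattice_term (p : nat) (y t : R) (m : Z) : R := sech (t + IZR m * y) ^ p.
Definition lattice_sum (p : nat) (y t : R) : R := zsum (lattice_term p y t).

Lemma lattice_sum_bound y t : 0 < y ->
  is_zsum (lattice_term 1 y t) (lattice_sum 1 y t) /\
  lattice_sum 1 y t <= 2 * (exp (- t) + exp (t - y)) / (1 - exp (- y)).
Proof.
  intros Hy.
  destruct (series_sech t y Hy) as [l1 [H1 B1]].
  destruct (series_sech (y - t) y Hy) as [l2 [H2 B2]].
  assert (Z : is_zsum (lattice_term 1 y t) (l1 + l2)).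
  { exists l1, l2; repeat split.
    - apply is_series_ext with (2 := H1). intros n; unfold lattice_term.
      rewrite <- INR_IZR_INZ; simpl; ring.
    - apply is_series_ext with (2 := H2). intros n; unfold lattice_term.
      rewrite minus_IZR, opp_IZR, <- INR_IZR_INZ, pow_1, <- sech_opp.
      f_equal; ring. }
  unfold lattice_sum; rewrite (is_zsum_unique _ _ Z). split; [exact Z|].
  replace (t - y) with (- (y - t)) by ring. unfold Rdiv in *; lra.
Qed.

Lemma lattice_sum_correct p y t : 0 < y ->
  is_zsum (lattice_term (S p) y t) (lattice_sum (S p) y t).
Proof.
  intros Hy; apply zsum_correct.
  apply ex_zsum_dominated with (lattice_term 1 y t).
  - intros m; unfold lattice_term; rewrite Rabs_pos_eq.
    2:{ apply pow_le, Rlt_le, sech_pos. }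
    set (x := sech _). simpl.
    assert (x ^ p <= 1).
    { rewrite <- (pow1 p). apply pow_incr; split; [apply Rlt_le, sech_pos|apply sech_le_1]. }
    pose proof (sech_pos (t + IZR m * y)); fold x in H0. nra.
  - eexists; now apply lattice_sum_bound.
Qed.

Lemma lattice_sum_opp p y t : 0 < y -> lattice_sum (S p) y (- t) = lattice_sum (S p) y t.
Proof.
  intros Hy; apply is_zsum_unique.
  apply is_zsum_ext with (2 := is_zsum_opp _ _ (lattice_sum_correct p y t Hy)).
  intros m; unfold lattice_term; rewrite opp_IZR, <- sech_opp; do 2 f_equal; ring.
Qed.

Lemma lattice_sum_period p y t : 0 < y -> lattice_sum (S p) y (t + y) = lattice_sum (S p) y t.
Proof.
  intros Hy; apply is_zsum_unique.
  apply is_zsum_ext with (2 := is_zsum_shift _ _ 1 (lattice_sum_correct p y t Hy)).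
  intros m; unfold lattice_term; rewrite plus_IZR; do 2 f_equal; ring.
Qed.

Lemma lattice_sum_halve p y t : 0 < y ->
  lattice_sum (S p) y t = lattice_sum (S p) (2 * y) t + lattice_sum (S p) (2 * y) (t + y).
Proof.
  intros Hy; apply is_zsum_unique. apply is_zsum_even_odd.
  - apply is_zsum_ext with (2 := lattice_sum_correct p (2 * y) t ltac:(lra)).
    intros m; unfold lattice_term; rewrite mult_IZR; do 2 f_equal; ring.
  - apply is_zsum_ext with (2 := lattice_sum_correct p (2 * y) (t + y) ltac:(lra)).
    intros m; unfold lattice_term; rewrite plus_IZR, mult_IZR; do 2 f_equal; ring.
Qed.

Lemma is_zsum_telescope (h : Z -> R) (lp lm : R) :
  is_lim_seq (fun n => h (Z.of_nat n)) lp ->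
  is_lim_seq (fun n => h (- Z.of_nat n)%Z) lm ->
  is_zsum (fun m => h m - h (m - 1)%Z) (lp - lm).
Proof.
  intros Hp Hm.
  exists (lp - h (-1)%Z), (h (-1)%Z - lm); repeat split; [| |ring].
  - assert (H : is_lim_seq (fun n => h (Z.of_nat n) - h (-1)%Z) (lp - h (-1)%Z)).
    { apply is_lim_seq_minus'; auto; apply is_lim_seq_const. }
    apply is_lim_seq_ext with (2 := H). induction n as [|n IH].
    + rewrite sum_O; reflexivity.
    + rewrite sum_Sn, <- IH; change plus with Rplus.
      replace (Z.of_nat (S n) - 1)%Z with (Z.of_nat n) by lia; ring.
  - assert (H : is_lim_seq (fun n => h (-1)%Z - h (- Z.of_nat (S (S n)))%Z) (h (-1)%Z - lm)).
    { apply is_lim_seq_minus'; [apply is_lim_seq_const|].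
      apply (is_lim_seq_incr_n (fun n => h (- Z.of_nat n)%Z) 2) in Hm.
      apply is_lim_seq_ext with (2 := Hm). intros n; do 2 f_equal; lia. }
    apply is_lim_seq_ext with (2 := H). induction n as [|n IH].
    + rewrite sum_O; reflexivity.
    + rewrite sum_Sn, <- IH; change plus with Rplus.
      replace (- Z.of_nat (S n) - 1)%Z with (- Z.of_nat (S (S n)))%Z by lia.
      replace (- Z.of_nat (S (S n)) - 1)%Z with (- Z.of_nat (S (S (S n))))%Z by lia.
      ring.
Qed.

Lemma tanh_bounds x : 1 - 2 * exp (- (2 * x)) <= tanh x <= 1.
Proof.
  assert (Hx := exp_pos x). assert (Hy := exp_pos (- x)).
  replace (- (2 * x)) with (- x + - x) by ring. rewrite exp_plus.
  assert (E : exp x * exp (- x) = 1) by (rewrite <- exp_plus, Rplus_opp_r; apply exp_0).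
  assert (Ht : tanh x * (exp x + exp (- x)) = exp x - exp (- x)).
  { unfold tanh, sinh, cosh; field; lra. }
  set (a := exp x) in *; set (b := exp (- x)) in *. split; nra.
Qed.

Lemma tanh_opp x : tanh (- x) = - tanh x.
Proof.
  unfold tanh, sinh; rewrite cosh_opp, Ropp_involutive. field.
  generalize (cosh_pos x); lra.
Qed.

Lemma lim_tanh t y : 0 < y -> is_lim_seq (fun n => tanh (t + INR n * y)) 1.
Proof.
  intros Hy.
  apply is_lim_seq_le_le with (fun n => 1 - 2 * exp (- (2 * t)) * exp (- (2 * y)) ^ n)
    (fun _ => 1).
  - intros n; rewrite <- exp_mult_INR, Rmult_assoc, <- exp_plus.
    generalize (tanh_bounds (t + INR n * y)).
    replace (- (2 * (t + INR n * y))) with (- (2 * t) + INR n * - (2 * y)) by ring. auto.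
  - replace 1 with (1 - 2 * exp (- (2 * t)) * 0) at 1 by ring.
    apply is_lim_seq_minus'; [apply is_lim_seq_const|].
    apply (is_lim_seq_scal_l _ (2 * exp (- (2 * t))) 0), is_lim_seq_geom.
    rewrite Rabs_pos_eq; [apply exp_neg_lt_1; lra|apply Rlt_le, exp_pos].
  - apply is_lim_seq_const.
Qed.

(** Telescoping: a shift by one contributes tanh (+oo) - tanh (-oo) = 2, and a
    shift by d is made of d such shifts. *)
Lemma is_zsum_tanh_diff y t (d : Z) : 0 < y ->
  is_zsum (fun m => tanh (t + IZR (m + d) * y) - tanh (t + IZR m * y)) (2 * IZR d).
Proof.
  intros Hy. set (h := fun m : Z => tanh (t + IZR m * y)).
  assert (H1 : is_zsum (fun m => h (m + 1)%Z - h m) 2).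
  { assert (H : is_zsum (fun m => h m - h (m - 1)%Z) (1 - - (1))).
    { apply is_zsum_telescope.
      - apply is_lim_seq_ext with (2 := lim_tanh t y Hy).
        intros n; unfold h; now rewrite INR_IZR_INZ.
      - apply is_lim_seq_ext with (fun n => - tanh (- t + INR n * y)).
        + intros n; unfold h; rewrite <- tanh_opp, opp_IZR, INR_IZR_INZ; f_equal; ring.
        + apply (is_lim_seq_opp _ 1), lim_tanh, Hy. }
    replace (1 - - (1)) with 2 in H by ring.
    apply is_zsum_succ in H. apply is_zsum_ext with (2 := H).
    intros m; simpl; do 2 f_equal; lia. }
  assert (Hn : forall n : nat, is_zsum (fun m => h (m + Z.of_nat n)%Z - h m) (2 * INR n)).
  { induction n as [|n IH].
    - apply is_zsum_ext with (fun m => 0 * (h (m + 1)%Z - h m)).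
      + intros m; rewrite Z.add_0_r; ring.
      + replace (2 * INR 0) with (0 * 2) by (simpl; ring). now apply is_zsum_scal.
    - pose proof (is_zsum_plus _ _ _ _ (is_zsum_shift _ _ (Z.of_nat n) H1) IH) as H.
      rewrite S_INR. replace (2 * (INR n + 1)) with (2 + 2 * INR n) by ring.
      apply is_zsum_ext with (2 := H). intros m; cbv beta.
      replace (m + Z.of_nat n + 1)%Z with (m + Z.of_nat (S n))%Z by lia. ring. }
  destruct (Z_le_gt_dec 0 d) as [Hd|Hd].
  - rewrite <- (Z2Nat.id d Hd), <- INR_IZR_INZ. apply Hn.
  - pose proof (is_zsum_scal (-1) _ _ (is_zsum_shift _ _ d (Hn (Z.to_nat (- d))))) as H.
    rewrite INR_IZR_INZ, Z2Nat.id, opp_IZR in H by lia.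
    replace (2 * IZR d) with (-1 * (2 * - IZR d)) by ring.
    apply is_zsum_ext with (2 := H). intros m; cbv beta.
    replace (m + d + - d)%Z with m by ring. unfold h; ring.
Qed.

Lemma sech_mul_sech u v : u <> v ->
  sech u * sech v = / sinh (u - v) * (tanh u - tanh v).
Proof.
  intros H. assert (Hs : sinh (u - v) <> 0) by (apply sinh_neq_0; lra).
  unfold sech, tanh. rewrite sinh_minus in *.
  assert (Hu := cosh_pos u); assert (Hv := cosh_pos v). field; repeat split; lra.
Qed.

Lemma lattice_step_neq_0 y (d : Z) : 0 < y -> d <> 0%Z -> IZR d * y <> 0.
Proof.
  intros Hy Hd. apply Rmult_integral_contrapositive; split; [|lra].
  now apply not_0_IZR.
Qed.

Lemma is_zsum_sech_sech y t (d : Z) : 0 < y -> d <> 0%Z ->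
  is_zsum (fun m => sech (t + IZR (m + d) * y) * sech (t + IZR m * y))
    (2 * IZR d / sinh (IZR d * y)).
Proof.
  intros Hy Hd. pose proof (lattice_step_neq_0 y d Hy Hd) as Hdy.
  pose proof (is_zsum_scal (/ sinh (IZR d * y)) _ _ (is_zsum_tanh_diff y t d Hy)) as H.
  replace (2 * IZR d / _) with (/ sinh (IZR d * y) * (2 * IZR d)) by (unfold Rdiv; ring).
  apply is_zsum_ext with (2 := H). intros m; cbv beta.
  assert (E : t + IZR (m + d) * y - (t + IZR m * y) = IZR d * y)
    by (rewrite plus_IZR; ring).
  rewrite sech_mul_sech by lra. now rewrite E.
Qed.

(** Multiplication of two lattice sums along the diagonals, which are indexed
    by the difference d of the two summation indices. *)
Lemma lattice_sum_mul p q y t : 0 < y ->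
  exists c, (forall d, is_zsum (fun m => lattice_term (S p) y t (m + d)%Z * lattice_term (S q) y t m) (c d))
   /\ is_zsum c (lattice_sum (S p) y t * lattice_sum (S q) y t).
Proof.
  intros Hy.
  apply (tonelli_Z (fun m d => lattice_term (S p) y t (m + d)%Z * lattice_term (S q) y t m)
    (fun m => lattice_sum (S p) y t * lattice_term (S q) y t m)).
  - intros i j; apply Rmult_le_pos; apply pow_le, Rlt_le, sech_pos.
  - intros i. pose proof (is_zsum_scal (lattice_term (S q) y t i) _ _
      (is_zsum_shift _ _ i (lattice_sum_correct p y t Hy))) as H.
    rewrite Rmult_comm. apply is_zsum_ext with (2 := H).
    intros m; cbv beta. rewrite (Z.add_comm m i); ring.
  - apply is_zsum_scal. now apply lattice_sum_correct.
Qed.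

(** The diagonal d = 0 of the square is the sum of the squares, and every other
    diagonal telescopes to 2 d / sinh (d y), whatever t is. *)
Lemma lattice_sum_square y : 0 < y ->
  exists A, forall t, lattice_sum 1 y t ^ 2 = lattice_sum 2 y t + A.
Proof.
  intros Hy.
  exists (zsum (fun d => if Z.eq_dec d 0 then 0 else 2 * IZR d / sinh (IZR d * y))).
  intros t. destruct (lattice_sum_mul 0 0 y t Hy) as [c [Hc Hs]].
  pose proof (is_zsum_minus _ _ _ _ Hs (is_zsum_single (lattice_sum 2 y t))) as H.
  match goal with |- _ = _ + zsum ?e => assert (He : is_zsum e (lattice_sum 1 y t * lattice_sum 1 y t - lattice_sum 2 y t)) end.
  { apply is_zsum_ext with (2 := H). intros d; cbv beta.
    destruct (Z.eq_dec d 0) as [->|Hd].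
    - apply Rminus_diag_eq.
      refine (is_zsum_eq _ _ _ (Hc 0%Z) _).
      apply is_zsum_ext with (2 := lattice_sum_correct 1 y t Hy).
      intros m; rewrite Z.add_0_r; unfold lattice_term; ring.
    - rewrite Rminus_0_r. refine (is_zsum_eq _ _ _ (Hc d) _).
      apply is_zsum_ext with (2 := is_zsum_sech_sech y t d Hy Hd).
      intros m; unfold lattice_term; ring. }
  rewrite (is_zsum_unique _ _ He); ring.
Qed.

(** These are theta_3(q)^2 and theta_2(q)^2 for the nome q = exp (-y). *)
Definition theta_a (y : R) := lattice_sum 1 y 0.
Definition theta_c (y : R) := lattice_sum 1 y (y / 2).

Lemma theta_a_agm y : 0 < y -> theta_a y = theta_a (2 * y) + theta_c (2 * y).
Proof.
  intros Hy; unfold theta_a, theta_c. rewrite lattice_sum_halve by auto.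
  do 2 f_equal; lra.
Qed.

(** [lattice_sum_square] at y and at 2y shows that the product of the lattice
    sums of step 2y at t and t + y is the same for all t.  At t = 0 it is
    a(2y) c(2y); at t = - y/2 both factors are half of c(y). *)
Lemma theta_c_agm y : 0 < y -> theta_c y ^ 2 = 4 * theta_a (2 * y) * theta_c (2 * y).
Proof.
  intros Hy; unfold theta_a, theta_c.
  destruct (lattice_sum_square y Hy) as [A1 HA1].
  destruct (lattice_sum_square (2 * y) ltac:(lra)) as [A2 HA2].
  assert (H : forall t, 2 * lattice_sum 1 (2 * y) t * lattice_sum 1 (2 * y) (t + y) = A1 - 2 * A2).
  { intros t. generalize (HA1 t) (HA2 t) (HA2 (t + y)).
    rewrite !(lattice_sum_halve _ y t) by auto. nra. }
  replace (2 * y / 2) with (0 + y) by field.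
  pose proof (H 0) as H0. pose proof (H (y / 2 - y)) as H1.
  replace (y / 2 - y + y) with (y / 2) in H1 by ring.
  replace (y / 2 - y) with (- (y / 2)) in H1 by field.
  rewrite lattice_sum_opp in H1 by lra.
  rewrite lattice_sum_halve by auto.
  replace (y / 2 + y) with (- (y / 2) + 2 * y) by field.
  rewrite lattice_sum_period, lattice_sum_opp by lra. nra.
Qed.

Lemma sech_half_sq x : sech (x / 2) ^ 2 = 2 / (cosh x + 1).
Proof.
  assert (H : cosh x + 1 = 2 * cosh (x / 2) ^ 2).
  { unfold cosh. replace x with (x / 2 + x / 2) at 1 2 by field.
    rewrite Ropp_plus_distr, !exp_plus, exp_Ropp. field.
    generalize (exp_pos (x / 2)); lra. }
  rewrite H; unfold sech; generalize (cosh_pos (x / 2)); intros; field; lra.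
Qed.

Lemma cosh_plus u v : cosh (u + v) = cosh u * cosh v + sinh u * sinh v.
Proof. unfold cosh, sinh; rewrite Ropp_plus_distr, !exp_plus; field. Qed.

(** Partial fractions once more: the first term sums to a multiple of
    [theta_a], and the second one is odd in v. *)
Lemma sech_mul_sech_sq v d : d <> 0 ->
  sech (v + d) * sech v ^ 2 =
    / sinh d ^ 2 * (cosh d * sech v - sech (v + d)) - / sinh d * (tanh v * sech v).
Proof.
  intros H. pose proof (sinh_neq_0 d H) as Hs. unfold sech, tanh.
  pose proof (cosh_pos (v + d)) as Hu. pose proof (cosh_pos v) as Hv.
  pose proof (cosh_sq v) as H1. pose proof (cosh_sq d) as H2.
  rewrite cosh_plus in *.
  set (S := sinh d) in *; set (C := cosh d) in *.
  set (s := sinh v) in *; set (c := cosh v) in *.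
  apply Rmult_eq_reg_r with (S ^ 2 * c ^ 2 * (c * C + s * S)).
  2:{ apply Rgt_not_eq. apply Rmult_lt_0_compat; [|lra].
      apply Rmult_lt_0_compat; apply pow2_gt_0; auto; lra. }
  field_simplify; [|repeat split; lra|repeat split; lra].
  replace (C ^ 2) with (1 + S ^ 2) by lra. replace (c ^ 2) with (1 + s ^ 2) by lra. ring.
Qed.

Lemma is_zsum_odd f l : (forall m, f (- m)%Z = - f m) -> is_zsum f l -> l = 0.
Proof.
  intros Hf H. assert (l = -1 * l); [|lra].
  refine (is_zsum_eq _ _ _ (is_zsum_opp _ _ H) _).
  apply is_zsum_ext with (2 := is_zsum_scal (-1) _ _ H).
  intros m; rewrite Hf; ring.
Qed.

Lemma tanh_abs_le_1 x : Rabs (tanh x) <= 1.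
Proof.
  apply Rabs_le. generalize (tanh_bounds x) (tanh_bounds (- x)).
  rewrite tanh_opp; lra.
Qed.

Lemma is_zsum_sech_sech_sq y (d : Z) : 0 < y -> d <> 0%Z ->
  is_zsum (fun m => sech (IZR (m + d) * y) * sech (IZR m * y) ^ 2)
    (theta_a y * (sech (IZR d * (y / 2)) ^ 2 / 2)).
Proof.
  intros Hy Hd. pose proof (lattice_step_neq_0 y d Hy Hd) as Hdy.
  set (x := IZR d * y) in *.
  assert (Ha : is_zsum (fun m => sech (IZR m * y)) (theta_a y)).
  { apply is_zsum_ext with (2 := lattice_sum_correct 0 y 0 Hy).
    intros m; unfold lattice_term; rewrite pow_1, Rplus_0_l; reflexivity. }
  destruct (ex_zsum_dominated (fun m => tanh (IZR m * y) * sech (IZR m * y))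
    (fun m => sech (IZR m * y))) as [o Ho].
  { intros m; rewrite Rabs_mult, (Rabs_pos_eq (sech _)) by apply Rlt_le, sech_pos.
    generalize (tanh_abs_le_1 (IZR m * y)) (sech_pos (IZR m * y)); nra. }
  { now exists (theta_a y). }
  assert (Ho0 : o = 0).
  { apply is_zsum_odd with (2 := Ho). intros m.
    rewrite opp_IZR, <- Ropp_mult_distr_l, tanh_opp, sech_opp; ring. }
  pose proof (is_zsum_shift _ _ d Ha) as Had.
  pose proof (is_zsum_minus _ _ _ _
    (is_zsum_scal (/ sinh x ^ 2) _ _ (is_zsum_minus _ _ _ _ (is_zsum_scal (cosh x) _ _ Ha) Had))
    (is_zsum_scal (/ sinh x) _ _ Ho)) as H.
  replace (theta_a y * _) with
    (/ sinh x ^ 2 * (cosh x * theta_a y - theta_a y) - / sinh x * o).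
  - apply is_zsum_ext with (2 := H). intros m; cbv beta.
    replace (IZR (m + d) * y) with (IZR m * y + x) by (unfold x; rewrite plus_IZR; ring).
    now rewrite sech_mul_sech_sq.
  - replace (IZR d * (y / 2)) with (x / 2) by (unfold x; field).
    rewrite sech_half_sq, Ho0. pose proof (sinh_neq_0 x Hdy) as Hs.
    pose proof (cosh_pos x) as Hc. pose proof (cosh_sq x) as E.
    assert (sinh x ^ 2 <> 0) by now apply pow_nonzero.
    replace (sinh x ^ 2) with ((cosh x - 1) * (cosh x + 1)) in * by (ring_simplify; lra).
    assert (cosh x - 1 <> 0) by (intros K; apply H0; rewrite K; ring).
    field. split; lra.
Qed.

(** Write T, Q0 and Qh for the sum of sech^3 over the points m y and for the
    sums of sech^2 over the points m y and (m + 1/2) y.  The diagonals of the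
    product a Q0 are T for d = 0 and a sech^2 (d y / 2) / 2 otherwise, and the
    points d y / 2 are those of both lattices, so that
    a Q0 = T + a (Q0 + Qh - 1) / 2.  Since a^2 - c^2 = Q0 - Qh by
    [lattice_sum_square], this turns 2 T - a into a (a^2 - c^2). *)
Lemma lattice_sum_cubic y : 0 < y ->
  is_zsum (fun m => 2 * sech (IZR m * y) ^ 3 - sech (IZR m * y))
    (theta_a y * (theta_a y ^ 2 - theta_c y ^ 2)).
Proof.
  intros Hy. destruct (lattice_sum_mul 0 1 y 0 Hy) as [c [Hc Hs]].
  fold (theta_a y) in Hs.
  set (Q0 := lattice_sum 2 y 0) in *. set (Qh := lattice_sum 2 y (y / 2)).
  set (T := lattice_sum 3 y 0). set (a := theta_a y) in *.
  assert (Hq : is_zsum (fun d => sech (IZR d * (y / 2)) ^ 2) (Q0 + Qh)).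
  { pose proof (lattice_sum_halve 1 (y / 2) 0 ltac:(lra)) as E.
    replace (2 * (y / 2)) with y in E by field. rewrite Rplus_0_l in E.
    unfold Q0, Qh; rewrite <- E.
    apply is_zsum_ext with (2 := lattice_sum_correct 1 (y / 2) 0 ltac:(lra)).
    intros m; unfold lattice_term; now rewrite Rplus_0_l. }
  assert (HT : T = a * Q0 - a * ((Q0 + Qh) / 2 - 1 / 2)).
  { assert (H1 : is_zsum c (T + a / 2 * (Q0 + Qh) - a / 2)).
    { pose proof (is_zsum_plus _ _ _ _ (is_zsum_single (T - a / 2)) (is_zsum_scal (a / 2) _ _ Hq)) as H.
      replace (T + _ - _) with (T - a / 2 + a / 2 * (Q0 + Qh)) by ring.
      apply is_zsum_ext with (2 := H). intros d; cbv beta.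
      refine (is_zsum_eq _ _ _ _ (Hc d)).
      destruct (Z.eq_dec d 0) as [->|Hd].
      - rewrite Rmult_0_l, sech_0.
        replace (T - a / 2 + a / 2 * 1 ^ 2) with T by field.
        apply is_zsum_ext with (2 := lattice_sum_correct 2 y 0 Hy).
        intros m; rewrite Z.add_0_r; unfold lattice_term; ring.
      - replace (0 + a / 2 * sech (IZR d * (y / 2)) ^ 2) with
          (a * (sech (IZR d * (y / 2)) ^ 2 / 2)) by field.
        apply is_zsum_ext with (2 := is_zsum_sech_sech_sq y d Hy Hd).
        intros m; unfold lattice_term; rewrite !Rplus_0_l, pow_1; reflexivity. }
    pose proof (is_zsum_eq _ _ _ Hs H1). lra. }
  assert (HA : a ^ 2 - theta_c y ^ 2 = Q0 - Qh).
  { destruct (lattice_sum_square y Hy) as [A HA].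
    unfold a, theta_a, theta_c, Q0, Qh; rewrite !HA; ring. }
  replace (a * (a ^ 2 - theta_c y ^ 2)) with (2 * T - a) by (rewrite HA, HT; field).
  pose proof (is_zsum_minus _ _ _ _ (is_zsum_scal 2 _ _ (lattice_sum_correct 2 y 0 Hy))
    (lattice_sum_correct 0 y 0 Hy)) as H.
  apply is_zsum_ext with (2 := H).
  intros m; unfold lattice_term; now rewrite Rplus_0_l, pow_1.
Qed.

(** * Gauss's transformation *)

Definition gauss_integrand (a b x : R) : R := / sqrt (a ^ 2 * cos x ^ 2 + b ^ 2 * sin x ^ 2).
Definition gauss_int (a b : R) : R := RInt (gauss_integrand a b) 0 (PI / 2).

Lemma sin_cos_sq x : sin x ^ 2 + cos x ^ 2 = 1.
Proof. generalize (sin2_cos2 x); unfold Rsqr; intros H; rewrite <- H; ring. Qed.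

Lemma quadratic_form_pos a b x : 0 < a -> 0 < b -> 0 < a ^ 2 * cos x ^ 2 + b ^ 2 * sin x ^ 2.
Proof.
  intros Ha Hb. pose proof (sin_cos_sq x).
  pose proof (pow2_ge_0 (sin x)). pose proof (pow2_ge_0 (cos x)).
  assert (0 < a ^ 2) by now apply pow_lt. assert (0 < b ^ 2) by now apply pow_lt.
  destruct (Rle_lt_dec (a ^ 2) (b ^ 2)); nra.
Qed.

Lemma continuous_gauss_integrand a b x : 0 < a -> 0 < b -> continuous (gauss_integrand a b) x.
Proof.
  intros Ha Hb. pose proof (quadratic_form_pos a b x Ha Hb) as H.
  apply (ex_derive_continuous (gauss_integrand a b)). unfold gauss_integrand. auto_derive.
  simpl in H; repeat split; try lra. apply Rgt_not_eq, sqrt_lt_R0; lra.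
Qed.

Lemma ex_RInt_gauss a b u v : 0 < a -> 0 < b -> ex_RInt (gauss_integrand a b) u v.
Proof.
  intros Ha Hb; apply (ex_RInt_continuous (gauss_integrand a b)).
  intros; now apply continuous_gauss_integrand.
Qed.

Lemma RInt_reflect (f : R -> R) u v s : (forall x, continuous f x) ->
  RInt (fun x => f (s - x)) u v = RInt f (s - v) (s - u).
Proof.
  intros Hf.
  pose proof (RInt_comp f (fun x => s - x) (fun _ => -1) u v) as H.
  rewrite <- (opp_RInt_swap f (s - u) (s - v)).
  2:{ apply (ex_RInt_continuous f); auto. }
  rewrite <- H.
  - rewrite <- RInt_opp.
    + apply RInt_ext; intros x _. change (f (s - x) = - (-1 * f (s - x))). ring.
    + apply (ex_RInt_continuous (fun y => scal (-1) (f (s - y)))). intros z _.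
      apply (continuous_scal_r (-1) (fun y => f (s - y))).
      apply (continuous_comp (fun y => s - y) f); auto.
      apply (ex_derive_continuous (fun y => s - y)); auto_derive; auto.
  - auto.
  - intros x _; split; [auto_derive; auto; ring|apply continuous_const].
Qed.

Lemma gauss_int_sym a b : 0 < a -> 0 < b -> gauss_int a b = gauss_int b a.
Proof.
  intros Ha Hb; unfold gauss_int.
  transitivity (RInt (gauss_integrand b a) (PI / 2 - PI / 2) (PI / 2 - 0)).
  2:{ f_equal; ring. }
  rewrite <- RInt_reflect by (intros; now apply continuous_gauss_integrand).
  apply RInt_ext; intros x _. unfold gauss_integrand.
  rewrite cos_shift, sin_shift. do 2 f_equal; ring.
Qed.

Lemma gauss_int_scal l a b : 0 < l -> 0 < a -> 0 < b ->
  gauss_int (l * a) (l * b) = / l * gauss_int a b.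
Proof.
  intros Hl Ha Hb; unfold gauss_int.
  rewrite <- (RInt_scal (V := R_CompleteNormedModule) (gauss_integrand a b)) by now apply ex_RInt_gauss.
  apply RInt_ext; intros x _. change (gauss_integrand (l * a) (l * b) x = / l * gauss_integrand a b x).
  unfold gauss_integrand.
  replace ((l * a) ^ 2 * _ + _) with (l ^ 2 * (a ^ 2 * cos x ^ 2 + b ^ 2 * sin x ^ 2)) by ring.
  pose proof (quadratic_form_pos a b x Ha Hb) as H.
  rewrite sqrt_mult by (try apply pow2_ge_0; lra). rewrite sqrt_pow2 by lra.
  apply Rinv_mult.
Qed.

Lemma gauss_int_pi a b : 0 < a -> 0 < b ->
  RInt (gauss_integrand a b) 0 PI = 2 * gauss_int a b.
Proof.
  intros Ha Hb; unfold gauss_int.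
  rewrite <- (RInt_Chasles (gauss_integrand a b) 0 (PI / 2) PI) by now apply ex_RInt_gauss.
  change plus with Rplus.
  assert (E : RInt (gauss_integrand a b) (PI / 2) PI = RInt (gauss_integrand a b) 0 (PI / 2)).
  { transitivity (RInt (gauss_integrand a b) (PI - PI / 2) (PI - 0)).
    { f_equal; field. }
    rewrite <- RInt_reflect by (intros; now apply continuous_gauss_integrand).
    apply RInt_ext; intros x _. unfold gauss_integrand.
    rewrite sin_PI_x, Rtrigo_facts.cos_pi_minus. do 2 f_equal; ring. }
  rewrite E. set (I := RInt _ _ _). change (I + I = 2 * I). ring.
Qed.

Lemma is_derive_atan_quotient (N D : R -> R) x dN dD :
  is_derive N x dN -> is_derive D x dD -> 0 < D x ->
  is_derive (fun x => atan (N x / D x)) x ((dN * D x - N x * dD) / (D x ^ 2 + N x ^ 2)).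
Proof.
  intros HN HD H. auto_derive.
  - repeat split; [now exists dN|now exists dD|lra].
  - replace (Derive _ x) with dN by (symmetry; now apply is_derive_unique).
    replace (Derive _ x) with dD by (symmetry; now apply is_derive_unique).
    unfold Rsqr. field. split; nra.
Qed.

(** The substitution phi defined by tan (phi - x) = (b / a) tan x doubles the
    interval, from [0, PI/2] to [0, PI].  Written as 2 x - atan (N / D), it is
    smooth up to the end point PI/2. *)
Lemma gauss_transformation a b g : 0 < a -> 0 < b -> 0 < g -> g ^ 2 = a * b ->
  gauss_int ((a + b) / 2) g = gauss_int a b.
Proof.
  intros Ha Hb Hg E.
  set (N := fun x => (a - b) * sin x * cos x).
  set (D := fun x => a * cos x ^ 2 + b * sin x ^ 2).
  set (R2 := fun x => a ^ 2 * cos x ^ 2 + b ^ 2 * sin x ^ 2).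
  set (phi := fun x => 2 * x - atan (N x / D x)).
  set (dphi := fun x => (a + b) * D x / R2 x).
  assert (HD : forall x, 0 < D x).
  { intros x; unfold D. pose proof (quadratic_form_pos (sqrt a) (sqrt b) x
      (sqrt_lt_R0 _ Ha) (sqrt_lt_R0 _ Hb)) as H.
    rewrite !pow2_sqrt in H; lra. }
  assert (HR : forall x, 0 < R2 x) by (intros; now apply quadratic_form_pos).
  (* D and N are the real and imaginary parts of a complex number of squared
     modulus R2 and of argument x minus atan ((b / a) tan x). *)
  assert (HND : forall x, D x ^ 2 + N x ^ 2 = R2 x).
  { intros x; unfold D, N, R2. replace (cos x ^ 2) with (1 - sin x ^ 2) by (generalize (sin_cos_sq x); lra).
    replace (((a - b) * sin x * cos x) ^ 2) with ((a - b) ^ 2 * sin x ^ 2 * cos x ^ 2) by ring.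
    replace (cos x ^ 2) with (1 - sin x ^ 2) by (generalize (sin_cos_sq x); lra). ring. }
  assert (Hphi : forall x, is_derive phi x (dphi x)).
  { intros x. pose proof (HD x) as Hd. pose proof (HR x) as Hr. pose proof (HND x) as Hn.
    pose proof (sin_cos_sq x) as Hsc.
    assert (HdN : is_derive N x ((a - b) * (cos x ^ 2 - sin x ^ 2))).
    { unfold N; auto_derive; auto; ring. }
    assert (HdD : is_derive D x (2 * (b - a) * sin x * cos x)).
    { unfold D; auto_derive; auto; ring. }
    pose proof (is_derive_atan_quotient N D x _ _ HdN HdD Hd) as Ha2. rewrite Hn in Ha2.
    replace (dphi x) with (2 - ((a - b) * (cos x ^ 2 - sin x ^ 2) * D x
      - N x * (2 * (b - a) * sin x * cos x)) / R2 x).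
    - apply (is_derive_minus (fun x => 2 * x) (fun x => atan (N x / D x)) x 2); [|exact Ha2].
      auto_derive; auto; ring.
    - unfold dphi. apply Rmult_eq_reg_r with (R2 x); [|lra].
      field_simplify; [|lra|lra].
      unfold R2, N, D. replace (cos x ^ 2) with (1 - sin x ^ 2) by lra.
      ring_simplify. replace (cos x ^ 2) with (1 - sin x ^ 2) by lra. ring. }
  assert (Hcont : forall x, continuous dphi x).
  { intros x; pose proof (HR x) as Hr.
    apply (ex_derive_continuous dphi). unfold dphi, D, R2 in *; auto_derive.
    simpl in *; lra. }
  assert (Hpull : forall x, dphi x * gauss_integrand ((a + b) / 2) g (phi x)
     = 2 * gauss_integrand a b x).
  { intros x. pose proof (HD x) as Hd. pose proof (HR x) as Hr. pose proof (HND x) as Hn.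
    pose proof (sin_cos_sq x) as Hsc.
    assert (Hq : 0 < 1 + (N x / D x)²) by (generalize (Rle_0_sqr (N x / D x)); lra).
    assert (Hq' : 1 + (N x / D x)² = R2 x / D x ^ 2) by (rewrite <- Hn; unfold Rsqr; field; lra).
    assert (Hs2 : sqrt (1 + (N x / D x)²) ^ 2 = R2 x / D x ^ 2) by (rewrite pow2_sqrt; lra).
    assert (Hs0 : 0 < sqrt (1 + (N x / D x)²)) by now apply sqrt_lt_R0.
    assert (Hcos : cos (phi x) ^ 2 = (a * cos x ^ 2 - b * sin x ^ 2) ^ 2 / R2 x).
    { unfold phi. rewrite cos_minus, cos_atan, sin_atan, cos_2a, sin_2a.
      set (q := sqrt _) in *.
      replace (_ ^ 2) with (((cos x * cos x - sin x * sin x) + 2 * sin x * cos x * (N x / D x)) ^ 2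
        / q ^ 2) by (field; lra).
      rewrite Hs2.
      replace (cos x * cos x - sin x * sin x + 2 * sin x * cos x * (N x / D x)) with
        ((a * cos x ^ 2 - b * sin x ^ 2) / D x); [field; lra|].
      apply Rmult_eq_reg_r with (D x); [|lra]. field_simplify; [|lra|lra].
      unfold N, D. replace (cos x ^ 2) with (1 - sin x ^ 2) by lra.
      ring_simplify. replace (cos x ^ 2) with (1 - sin x ^ 2) by lra. ring. }
    assert (Hsin : sin (phi x) ^ 2 = (a + b) ^ 2 * sin x ^ 2 * cos x ^ 2 / R2 x).
    { replace (sin (phi x) ^ 2) with (1 - cos (phi x) ^ 2) by (generalize (sin_cos_sq (phi x)); lra).
      rewrite Hcos. apply Rmult_eq_reg_r with (R2 x); [|lra]. field_simplify; [|lra|lra].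
      unfold R2. replace (cos x ^ 4) with ((1 - sin x ^ 2) ^ 2) by (rewrite <- Hsc; ring).
      replace (cos x ^ 2) with (1 - sin x ^ 2) by lra. ring. }
    unfold gauss_integrand, dphi.
    replace (((a + b) / 2) ^ 2 * cos (phi x) ^ 2 + g ^ 2 * sin (phi x) ^ 2)
      with ((((a + b) / 2 * D x) / sqrt (R2 x)) ^ 2).
    - rewrite sqrt_pow2.
      + unfold R2. fold (R2 x). pose proof (sqrt_lt_R0 _ Hr) as Hr'.
        replace (R2 x) with (sqrt (R2 x) ^ 2) at 1 by (apply pow2_sqrt; lra).
        field. repeat split; lra.
      + apply Rlt_le, Rdiv_lt_0_compat; [nra|now apply sqrt_lt_R0].
    - rewrite Hcos, Hsin, E.
      unfold Rdiv at 1; rewrite Rpow_mult_distr, <- Rinv_pow_depr, pow2_sqrt by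
        (try lra; apply Rgt_not_eq, sqrt_lt_R0; lra).
      apply Rmult_eq_reg_r with (R2 x); [|lra]. field_simplify; [|lra|lra].
      unfold D. field. }
  pose proof (RInt_comp (gauss_integrand ((a + b) / 2) g) phi dphi 0 (PI / 2)) as H.
  assert (H0 : phi 0 = 0).
  { unfold phi, N. rewrite sin_0. replace ((a - b) * 0 * cos 0 / D 0) with 0 by (unfold Rdiv; ring).
    rewrite atan_0; ring. }
  assert (H1 : phi (PI / 2) = PI).
  { unfold phi, N. rewrite cos_PI2. replace ((a - b) * sin (PI / 2) * 0 / D (PI / 2)) with 0 by (unfold Rdiv; ring).
    rewrite atan_0; field. }
  rewrite H0, H1, gauss_int_pi in H by lra.
  assert (H2 : 2 * gauss_int a b = 2 * gauss_int ((a + b) / 2) g); [|lra].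
  rewrite <- H.
  - unfold gauss_int.
    rewrite <- (RInt_scal (V := R_CompleteNormedModule) (gauss_integrand a b)) by now apply ex_RInt_gauss.
    apply RInt_ext; intros x _. symmetry; exact (Hpull x).
  - intros; apply continuous_gauss_integrand; lra.
  - auto.
Qed.

(** * Estimates of the integral *)

Lemma RInt_const_quarter (v : R) : RInt (fun _ => v) 0 (PI / 2) = PI / 2 * v.
Proof. rewrite RInt_const. change ((PI / 2 - 0) * v = PI / 2 * v). ring. Qed.

Lemma gauss_int_bounds a b : 0 < b -> b <= a ->
  PI / 2 * / a <= gauss_int a b <= PI / 2 * / b.
Proof.
  intros Hb Hab. pose proof PI_RGT_0.
  assert (Hx : forall x, b <= sqrt (a ^ 2 * cos x ^ 2 + b ^ 2 * sin x ^ 2) <= a).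
  { intros x; pose proof (sin_cos_sq x) as E. pose proof (pow2_ge_0 (cos x)). pose proof (pow2_ge_0 (sin x)).
    assert (0 <= b ^ 2) by apply pow2_ge_0. assert (b ^ 2 <= a ^ 2) by (apply pow_incr; lra).
    split.
    - rewrite <- (sqrt_pow2 b) at 1 by lra. apply sqrt_le_1_alt; nra.
    - rewrite <- (sqrt_pow2 a) at 2 by lra. apply sqrt_le_1_alt; nra. }
  rewrite <- !RInt_const_quarter. unfold gauss_int.
  assert (Hex : ex_RInt (gauss_integrand a b) 0 (PI / 2)) by (apply ex_RInt_gauss; lra).
  split; (apply RInt_le; [lra|exact Hex || apply ex_RInt_const|exact Hex || apply ex_RInt_const|]);
    intros x _; apply Rinv_le_contravar; destruct (Hx x); lra.
Qed.

(** With the weight cos x in the numerator the integral is elementary and equals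
    the logarithm.  The weight costs at most 1/b at each point, because
    1 - cos x <= sin x on [0, PI/2] and the square root is at least b sin x. *)
Lemma gauss_int_log a b c : 0 < c -> 0 < a -> 0 < b -> b ^ 2 = a ^ 2 - c ^ 2 ->
  ln ((a + b) / c) / b <= gauss_int a c <= ln ((a + b) / c) / b + PI / 2 * / b.
Proof.
  intros Hc Ha Hb E. pose proof PI_RGT_0 as Hpi.
  rewrite gauss_int_sym by auto.
  set (w := fun x => cos x * gauss_integrand c a x).
  set (f := fun x => ln (b * sin x + sqrt (c ^ 2 * cos x ^ 2 + a ^ 2 * sin x ^ 2)) / b).
  assert (HD : forall x, c ^ 2 * cos x ^ 2 + a ^ 2 * sin x ^ 2 = c ^ 2 + (b * sin x) ^ 2).
  { intros x; pose proof (sin_cos_sq x). replace (cos x ^ 2) with (1 - sin x ^ 2) by lra.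
    replace (a ^ 2) with (b ^ 2 + c ^ 2) by lra; ring. }
  assert (Habs : forall x, Rabs (b * sin x) < sqrt (c ^ 2 * cos x ^ 2 + a ^ 2 * sin x ^ 2)).
  { intros x; rewrite HD, <- sqrt_Rsqr_abs. apply sqrt_lt_1_alt. split; [apply Rle_0_sqr|].
    unfold Rsqr; assert (0 < c ^ 2) by now apply pow_lt. nra. }
  assert (Hw : forall x, continuous w x).
  { intros x; apply (continuous_mult (cos : R -> R) (gauss_integrand c a)).
    - apply (ex_derive_continuous cos); auto_derive; auto.
    - now apply continuous_gauss_integrand. }
  assert (HI : is_RInt w 0 (PI / 2) (ln ((a + b) / c) / b)).
  { assert (Hf : f (PI / 2) - f 0 = ln ((a + b) / c) / b).
    { unfold f. rewrite sin_PI2, cos_PI2, sin_0, cos_0.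
      replace (c ^ 2 * 0 ^ 2 + a ^ 2 * 1 ^ 2) with (a ^ 2) by ring.
      replace (c ^ 2 * 1 ^ 2 + a ^ 2 * 0 ^ 2) with (c ^ 2) by ring.
      rewrite !sqrt_pow2 by lra.
      replace (b * 0 + c) with c by ring. replace (b * 1 + a) with (a + b) by ring.
      rewrite ln_div by lra. field; lra. }
    rewrite <- Hf. apply (is_RInt_derive f w); [|intros; apply Hw].
    intros x _. pose proof (quadratic_form_pos c a x Hc Ha) as Hp.
    pose proof (Habs x) as Hx. apply Rabs_def2 in Hx.
    unfold f, w, gauss_integrand. 
    auto_derive.
    - simpl in Hp, Hx; repeat split; lra.
    - replace (c * (c * 1)) with (c ^ 2) by ring. replace (a * (a * 1)) with (a ^ 2) by ring.
      replace (sin x * (sin x * 1)) with (sin x ^ 2) by ring.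
      replace (cos x * (cos x * 1)) with (cos x ^ 2) by ring.
      set (s := sqrt _) in *. replace (a ^ 2) with (b ^ 2 + c ^ 2) by lra.
      field. repeat split; lra. }
  split.
  - rewrite <- (is_RInt_unique _ _ _ _ HI). unfold gauss_int.
    apply RInt_le; [lra|eexists; exact HI|now apply ex_RInt_gauss|].
    intros x Hx. unfold w.
    assert (0 < gauss_integrand c a x).
    { apply Rinv_0_lt_compat, sqrt_lt_R0; now apply quadratic_form_pos. }
    generalize (COS_bound x); nra.
  - rewrite <- (is_RInt_unique _ _ _ _ HI), <- RInt_const_quarter.
    rewrite <- (RInt_plus (V := R_CompleteNormedModule) w (fun _ => / b));
      [|eexists; exact HI|apply ex_RInt_const].
    unfold gauss_int. apply RInt_le; [lra|now apply ex_RInt_gauss| |].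
    { apply (ex_RInt_plus w (fun _ => / b)); [eexists; exact HI|apply ex_RInt_const]. }
    intros x Hx. change (gauss_integrand c a x <= w x + / b). unfold w, gauss_integrand.
    pose proof (Habs x) as H1. set (s := sqrt _) in *.
    pose proof (sin_gt_0 x ltac:(lra) ltac:(lra)) as Hs.
    pose proof (cos_gt_0 x ltac:(lra) ltac:(lra)) as Hcs.
    pose proof (sin_cos_sq x) as Hsc. pose proof (COS_bound x).
    rewrite Rabs_pos_eq in H1 by nra.
    assert (0 < s) by nra.
    apply Rmult_le_reg_r with (b * s); [nra|]. field_simplify; [|lra|lra]. nra.
Qed.

(** * Limits of the theta constants *)

Lemma exp_opp_le_half y : 1 <= y -> exp (- y) <= 1 / 2.
Proof.
  intros Hy. pose proof (exp_ineq1_le y). rewrite exp_Ropp.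
  replace (1 / 2) with (/ 2) by lra. apply Rinv_le_contravar; lra.
Qed.

Lemma half_sum_bound y x z : 1 <= y -> 0 <= z -> x <= z / (1 - exp (- y)) -> x <= 2 * z.
Proof.
  intros Hy Hz H. pose proof (exp_opp_le_half y Hy). eapply Rle_trans; [exact H|].
  assert (/ (1 - exp (- y)) <= / (1 / 2)) by (apply Rinv_le_contravar; lra).
  replace (/ (1 / 2)) with 2 in H1 by field.
  unfold Rdiv; rewrite (Rmult_comm 2). now apply Rmult_le_compat_l.
Qed.

Lemma theta_a_bounds y : 1 <= y -> 1 <= theta_a y <= 1 + 8 * exp (- y).
Proof.
  intros Hy1. assert (Hy : 0 < y) by lra. destruct (series_sech y y Hy) as [l [Hl Bl]].
  assert (H : theta_a y = 1 + l + l).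
  { apply is_zsum_unique. exists (1 + l), l; repeat split.
    - assert (H1 : is_series (fun n => lattice_term 1 y 0 (Z.of_nat (S n))) l).
      { apply is_series_ext with (2 := Hl). intros n; unfold lattice_term.
        rewrite <- INR_IZR_INZ, S_INR, pow_1; f_equal; ring. }
      apply (series_decr_1 (fun n => lattice_term 1 y 0 (Z.of_nat n))) in H1.
      unfold lattice_term at 2 in H1. simpl Z.of_nat in H1.
      now rewrite Rmult_0_l, Rplus_0_r, sech_0, pow1 in H1.
    - apply is_series_ext with (2 := Hl). intros n; unfold lattice_term.
      rewrite minus_IZR, opp_IZR, <- INR_IZR_INZ, pow_1, <- sech_opp; f_equal; ring. }
  pose proof (exp_pos (- y)).
  pose proof (half_sum_bound y l (2 * exp (- y)) Hy1 ltac:(lra) (proj2 Bl)). lra.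
Qed.

Lemma theta_c_upper y : 1 <= y -> theta_c y <= 8 * exp (- (y / 2)).
Proof.
  intros Hy. destruct (lattice_sum_bound y (y / 2) ltac:(lra)) as [_ B].
  replace (y / 2 - y) with (- (y / 2)) in B by field. fold (theta_c y) in B.
  pose proof (exp_pos (- (y / 2))).
  pose proof (half_sum_bound y _ (2 * (exp (- (y / 2)) + exp (- (y / 2)))) Hy ltac:(lra) B). lra.
Qed.

Lemma theta_c_lower y : 0 < y -> exp (- (y / 2)) <= theta_c y.
Proof.
  intros Hy.
  apply Rle_trans with (sech (y / 2)); [apply sech_ge_exp; lra|].
  apply is_zsum_le with (2 := is_zsum_single (sech (y / 2)))
    (3 := lattice_sum_correct 0 y (y / 2) Hy).
  intros m; unfold lattice_term; rewrite pow_1.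
  destruct (Z.eq_dec m 0) as [->|_]; [rewrite Rmult_0_l, Rplus_0_r; lra|apply Rlt_le, sech_pos].
Qed.

Lemma theta_c_pos y : 0 < y -> 0 < theta_c y.
Proof. intros Hy; generalize (theta_c_lower y Hy) (exp_pos (- (y / 2))); lra. Qed.

Lemma is_lim_mult_R (f g : R -> R) x (lf lg : R) :
  is_lim f x lf -> is_lim g x lg -> is_lim (fun y => f y * g y) x (lf * lg).
Proof. intros Hf Hg. now apply (is_lim_mult f g x lf lg). Qed.

Lemma lim_exp_neg_scal c : 0 < c -> is_lim (fun y => exp (- (c * y))) p_infty 0.
Proof.
  intros Hc.
  apply (is_lim_comp exp (fun y => - (c * y)) p_infty 0 m_infty).
  - apply is_lim_exp_m.
  - replace m_infty with (Rbar_opp p_infty) by reflexivity.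
    apply is_lim_opp.
    apply is_lim_ext with (fun y => c * y); [auto|].
    replace p_infty with (Rbar_mult c p_infty) at 2.
    + apply is_lim_scal_l, is_lim_id.
    + simpl. destruct (Rle_dec 0 c) as [H|H]; [|lra].
      destruct (Rle_lt_or_eq_dec 0 c H); [reflexivity|lra].
  - exists 0; intros; discriminate.
Qed.

Lemma lim_theta_a : is_lim theta_a p_infty 1.
Proof.
  apply is_lim_le_le_loc with (fun _ => 1) (fun y => 1 + 8 * exp (- (1 * y))).
  - exists 1; intros y Hy; rewrite Rmult_1_l. apply theta_a_bounds; lra.
  - apply is_lim_const.
  - assert (H : is_lim (fun y => 1 + 8 * exp (- (1 * y))) p_infty (1 + 8 * 0)).
    { apply is_lim_plus'; [apply is_lim_const|].
      apply (is_lim_scal_l _ 8 p_infty 0), lim_exp_neg_scal; lra. }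
    now rewrite Rmult_0_r, Rplus_0_r in H.
Qed.

Lemma lim_theta_c : is_lim theta_c p_infty 0.
Proof.
  apply is_lim_le_le_loc with (fun _ => 0) (fun y => 8 * exp (- (1 / 2 * y))).
  - exists 1; intros y Hy. split; [apply Rlt_le, theta_c_pos; lra|].
    replace (1 / 2 * y) with (y / 2) by field. apply theta_c_upper; lra.
  - apply is_lim_const.
  - rewrite <- (Rmult_0_r 8). apply (is_lim_scal_l _ 8 p_infty 0), lim_exp_neg_scal; lra.
Qed.

(** * Evaluation of the integrals by the arithmetic-geometric mean *)

Lemma eq_of_doubling_invariant (h : R -> R) (l : R) :
  (forall y, 0 < y -> h (2 * y) = h y) -> is_lim h p_infty l ->
  forall y, 0 < y -> h y = l.
Proof.
  intros Hd Hl y Hy.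
  assert (Hn : forall n, h (2 ^ n * y) = h y).
  { induction n as [|n IH]; [simpl; f_equal; ring|].
    rewrite <- IH, <- (Hd (2 ^ n * y)) by (apply Rmult_lt_0_compat; auto; apply pow_lt; lra).
    f_equal; simpl; ring. }
  assert (Hs : is_lim_seq (fun n => 2 ^ n * y) p_infty).
  { replace p_infty with (Rbar_mult p_infty y).
    - apply is_lim_seq_scal_r. apply is_lim_seq_geom_p; lra.
    - simpl. destruct (Rle_dec 0 y) as [H|H]; [|lra].
      destruct (Rle_lt_or_eq_dec 0 y H); [reflexivity|lra]. }
  assert (H : is_lim_seq (fun _ : nat => h y) l).
  { apply is_lim_seq_ext with (1 := Hn).
    apply (is_lim_comp_seq h (fun n => 2 ^ n * y) p_infty l); auto.
    exists 0%nat; intros; discriminate. }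
  apply is_lim_seq_unique in H. rewrite Lim_seq_const in H. now injection H.
Qed.

Lemma theta_square_diff y : 0 < y ->
  theta_a y ^ 2 - theta_c y ^ 2 = (theta_a (2 * y) - theta_c (2 * y)) ^ 2.
Proof. intros Hy. rewrite theta_c_agm, theta_a_agm by auto. ring. Qed.

Lemma theta_a_pos y : 0 < y -> 0 < theta_a y.
Proof.
  intros Hy. rewrite theta_a_agm by auto.
  assert (0 <= theta_a (2 * y)); [|generalize (theta_c_pos (2 * y)); lra].
  apply is_zsum_le with (2 := is_zsum_single 0) (3 := lattice_sum_correct 0 (2 * y) 0 ltac:(lra)).
  intros m; destruct (Z.eq_dec m 0); apply pow_le, Rlt_le, sech_pos.
Qed.

(** By [theta_square_diff] the difference a - c cannot become negative, and if
    it vanished at y it would vanish at every 2^n y, against its limit 1. *)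
Lemma theta_c_lt_a y : 0 < y -> theta_c y < theta_a y.
Proof.
  intros Hy.
  pose proof (theta_a_pos y Hy). pose proof (theta_c_pos y Hy).
  pose proof (theta_square_diff y Hy) as E.
  pose proof (pow2_ge_0 (theta_a (2 * y) - theta_c (2 * y))) as Hge.
  destruct (Rtotal_order (theta_c y) (theta_a y)) as [|[Heq|]]; [auto| |nra].
  exfalso.
  (* The indicator of the set where a and c agree is invariant under doubling. *)
  set (h := fun y => if Req_EM_T (theta_a y) (theta_c y) then 1 else 0).
  assert (Hh : h y = 0).
  { apply (eq_of_doubling_invariant h 0); auto.
    - intros z Hz; unfold h. pose proof (theta_square_diff z Hz) as Ez.
      pose proof (theta_a_pos z Hz). pose proof (theta_c_pos z Hz).
      destruct (Req_EM_T (theta_a (2 * z)) (theta_c (2 * z)));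
        destruct (Req_EM_T (theta_a z) (theta_c z)); auto; exfalso; nra.
    - apply is_lim_ext_loc with (fun _ => 0); [|apply is_lim_const].
      assert (Hd : is_lim (fun y => theta_a y - theta_c y) p_infty (1 - 0))
        by exact (is_lim_minus' _ _ _ _ _ lim_theta_a lim_theta_c).
      apply is_lim_spec in Hd. destruct (Hd (mkposreal 1 Rlt_0_1)) as [M HM].
      exists M; intros z Hz. specialize (HM z Hz). simpl in HM.
      apply Rabs_def2 in HM. unfold h. destruct (Req_EM_T _ _); [exfalso; lra|auto]. }
  unfold h in Hh. destruct (Req_EM_T _ _); lra.
Qed.

(** This is theta_4(q)^2. *)
Definition theta_b (y : R) : R := theta_a (2 * y) - theta_c (2 * y).

Lemma theta_b_pos y : 0 < y -> 0 < theta_b y.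
Proof. intros Hy; unfold theta_b; generalize (theta_c_lt_a (2 * y)); lra. Qed.

Lemma theta_b_sq y : 0 < y -> theta_b y ^ 2 = theta_a y ^ 2 - theta_c y ^ 2.
Proof. intros Hy; now rewrite theta_square_diff. Qed.

Lemma lim_double f (l : R) : is_lim f p_infty l -> is_lim (fun y => f (2 * y)) p_infty l.
Proof.
  intros H. apply (is_lim_comp f (fun y => 2 * y) p_infty l p_infty); auto.
  - replace p_infty with (Rbar_mult 2 p_infty) at 2.
    + apply is_lim_scal_l, is_lim_id.
    + simpl. destruct (Rle_dec 0 2) as [K|K]; [|lra].
      destruct (Rle_lt_or_eq_dec 0 2 K); [reflexivity|lra].
  - exists 0; intros; discriminate.
Qed.

Lemma lim_theta_b : is_lim theta_b p_infty 1.
Proof.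
  replace 1 with (1 - 0) by ring.
  apply (is_lim_minus' (fun y => theta_a (2 * y)) (fun y => theta_c (2 * y)) p_infty 1 0);
   apply lim_double; [apply lim_theta_a|apply lim_theta_c].
Qed.

Lemma gauss_int_theta_ab y : 0 < y -> gauss_int (theta_a y) (theta_b y) = PI / 2.
Proof.
  apply (eq_of_doubling_invariant (fun y => gauss_int (theta_a y) (theta_b y))).
  - intros z Hz. pose proof (theta_a_pos z Hz) as Ha. pose proof (theta_b_pos z Hz) as Hb.
    rewrite <- (gauss_transformation (theta_a z) (theta_b z) (theta_b (2 * z))); auto.
    + f_equal. rewrite (theta_a_agm z) by auto. unfold theta_b; field.
    + apply theta_b_pos; lra.
    + rewrite theta_b_sq by lra. rewrite (theta_a_agm z) by auto. unfold theta_b; ring.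
  - assert (H : forall f, is_lim f p_infty 1 -> is_lim (fun y => PI / 2 * / f y) p_infty (PI / 2)).
    { intros f Hf. assert (Hinv : is_lim (fun y => / f y) p_infty (/ 1)).
      { apply (is_lim_inv f p_infty 1 Hf). intros K; injection K; lra. }
      pose proof (is_lim_mult_R _ _ _ _ _ (is_lim_const (PI / 2) p_infty) Hinv) as H.
      now rewrite Rinv_1, Rmult_1_r in H. }
    apply is_lim_le_le_loc with (fun y => PI / 2 * / theta_a y) (fun y => PI / 2 * / theta_b y).
    + exists 0; intros z Hz. apply gauss_int_bounds; [now apply theta_b_pos|].
      pose proof (theta_b_sq z Hz). pose proof (theta_b_pos z Hz).
      pose proof (theta_a_pos z Hz). pose proof (theta_c_pos z Hz). nra.
    + apply H, lim_theta_a.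
    + apply H, lim_theta_b.
Qed.

Lemma lim_inv_id : is_lim (fun y => / y) p_infty 0.
Proof. apply (is_lim_inv (fun y => y) p_infty p_infty); [apply is_lim_id|discriminate]. Qed.

(** Here Gauss's transformation runs backwards, from (a, c) at 2y to half of
    (a, c) at y, so that the integral doubles with y.  The limit of the quotient
    by y comes from [gauss_int_log] and from ln c = - y/2 + O(1). *)
Lemma gauss_int_theta_ac y : 0 < y -> gauss_int (theta_a y) (theta_c y) = y / 2.
Proof.
  intros Hy. cut (gauss_int (theta_a y) (theta_c y) * / y = 1 / 2).
  { intros E. replace (gauss_int _ _) with (gauss_int (theta_a y) (theta_c y) * / y * y) by (field; lra).
    rewrite E; field. }
  revert y Hy.
  apply (eq_of_doubling_invariant (fun y => gauss_int (theta_a y) (theta_c y) * / y)).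
  - intros z Hz. pose proof (theta_a_pos z Hz) as Ha. pose proof (theta_c_pos z Hz) as Hc.
    rewrite <- (gauss_transformation (theta_a (2 * z)) (theta_c (2 * z)) (/ 2 * theta_c z)); auto.
    + replace ((theta_a (2 * z) + theta_c (2 * z)) / 2) with (/ 2 * theta_a z)
        by (rewrite (theta_a_agm z) by auto; field).
      rewrite gauss_int_scal by (auto; lra). field; lra.
    + apply theta_a_pos; lra.
    + apply theta_c_pos; lra.
    + lra.
    + rewrite Rpow_mult_distr, theta_c_agm by auto. field.
  - assert (Hab : is_lim (fun y => ln (theta_a y + theta_b y)) p_infty (ln (1 + 1))).
    { apply (is_lim_comp_continuous (fun y => theta_a y + theta_b y) ln p_infty (1 + 1)).
      - exact (is_lim_plus' _ _ _ _ _ lim_theta_a lim_theta_b).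
      - apply (ex_derive_continuous ln). auto_derive; lra. }
    set (low := fun y => / theta_b y * (ln (theta_a y + theta_b y) * / y + (1 / 2 - ln 8 * / y))).
    set (up := fun y => / theta_b y * (ln (theta_a y + theta_b y) * / y + 1 / 2 + PI / 2 * / y)).
    assert (Hib : is_lim (fun y => / theta_b y) p_infty (/ 1)).
    { apply (is_lim_inv theta_b p_infty 1 lim_theta_b). intros K; injection K; lra. }
    assert (Hl0 : is_lim (fun y => ln (theta_a y + theta_b y) * / y) p_infty (ln (1 + 1) * 0)).
    { exact (is_lim_mult_R _ _ _ _ _ Hab lim_inv_id). }
    apply is_lim_le_le_loc with low up.
    + exists 1; intros y Hy1. assert (Hy : 0 < y) by lra.
      pose proof (theta_b_pos y Hy) as Hb. pose proof (theta_a_pos y Hy) as Ha.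
      pose proof (theta_c_pos y Hy) as Hc.
      pose proof (gauss_int_log _ _ _ Hc Ha Hb (theta_b_sq y Hy)) as [L1 L2].
      rewrite ln_div in L1, L2 by lra.
      assert (C1 : ln (theta_c y) <= ln 8 - y / 2).
      { replace (ln 8 - y / 2) with (ln (8 * exp (- (y / 2)))).
        - destruct (Req_dec (theta_c y) (8 * exp (- (y / 2)))) as [->|N]; [lra|].
          apply Rlt_le, ln_increasing; auto. pose proof (theta_c_upper y). lra.
        - rewrite ln_mult, ln_exp by (try apply exp_pos; lra). ring. }
      assert (C2 : - (y / 2) <= ln (theta_c y)).
      { rewrite <- (ln_exp (- (y / 2))). pose proof (theta_c_lower y Hy).
        destruct (Req_dec (theta_c y) (exp (- (y / 2)))) as [->|N]; [lra|].
        apply Rlt_le, ln_increasing; [apply exp_pos|lra]. }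
      assert (Hiy : 0 < / y) by now apply Rinv_0_lt_compat.
      assert (Hibp : 0 < / theta_b y) by now apply Rinv_0_lt_compat.
      unfold low, up. split.
      * eapply Rle_trans; [|apply Rmult_le_compat_r; [lra|exact L1]].
        replace (/ theta_b y * _) with ((ln (theta_a y + theta_b y) - (ln 8 - y / 2)) / theta_b y * / y) by (field; lra).
        apply Rmult_le_compat_r; [lra|]. apply Rmult_le_compat_r; lra.
      * eapply Rle_trans; [apply Rmult_le_compat_r; [lra|exact L2]|].
        replace (/ theta_b y * _) with (((ln (theta_a y + theta_b y) - - (y / 2)) / theta_b y + PI / 2 * / theta_b y) * / y) by (field; lra).
        apply Rmult_le_compat_r; [lra|]. apply Rplus_le_compat_r. apply Rmult_le_compat_r; lra.
    + replace (1 / 2) with (/ 1 * (ln (1 + 1) * 0 + (1 / 2 - ln 8 * 0))) by field.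
      apply (is_lim_mult_R _ _ _ _ _ Hib). apply (is_lim_plus' _ _ _ _ _ Hl0).
      apply is_lim_minus'; [apply is_lim_const|].
      exact (is_lim_mult_R _ _ _ _ _ (is_lim_const (ln 8) p_infty) lim_inv_id).
    + replace (1 / 2) with (/ 1 * (ln (1 + 1) * 0 + 1 / 2 + PI / 2 * 0)) by field.
      apply (is_lim_mult_R _ _ _ _ _ Hib). apply is_lim_plus'.
      * apply (is_lim_plus' _ _ _ _ _ Hl0), is_lim_const.
      * exact (is_lim_mult_R _ _ _ _ _ (is_lim_const (PI / 2) p_infty) lim_inv_id).
Qed.

(** * Termwise differentiation of series *)

(** Weierstrass's M-test: the remainder of order n is at most that of the
    dominating series, which does not depend on x. *)
Lemma CVU_dom_dominated (g : nat -> R -> R) (M : nat -> R) (D : R -> Prop) :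
  (forall n x, D x -> Rabs (g n x) <= M n) -> ex_series M ->
  CVU_dom (fun n x => sum_n (fun k => g k x) n) D.
Proof.
  intros Hg [SM HSM] eps.
  assert (HM : is_lim_seq (sum_n M) SM) by exact HSM.
  apply is_lim_seq_spec in HM. destruct (HM eps) as [N HN].
  exists N; intros n Hn x Hx. specialize (HN n Hn). apply Rabs_def2 in HN.
  assert (Hex : ex_series (fun k => g k x)).
  { apply ex_series_dominated with M; [auto|now exists SM]. }
  destruct Hex as [Sg HSg].
  change (Rabs (sum_n (fun k => g k x) n - Series (fun k => g k x)) < eps).
  rewrite (is_series_unique _ _ HSg).
  assert (H : forall k, Rabs (sum_n (fun k => g k x) n - sum_n (fun k => g k x) (n + k))
     <= sum_n M (n + k) - sum_n M n).
  { induction k as [|k IH].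
    - rewrite Nat.add_0_r, !Rminus_diag, Rabs_R0; lra.
    - rewrite Nat.add_succ_r, !sum_Sn; change plus with Rplus.
      specialize (Hg (S (n + k)) x Hx). apply Rabs_le_between in IH.
      apply Rabs_le_between in Hg. apply Rabs_le; lra. }
  apply Rle_lt_trans with (SM - sum_n M n); [|lra].
  assert (Hshift : forall (a : nat -> R) (l : R), is_series a l -> is_lim_seq (fun k => sum_n a (n + k)) l).
  { intros a l Ha. apply is_lim_seq_ext with (fun k => sum_n a (k + n)).
    - intros k; f_equal; lia.
    - now apply (is_lim_seq_incr_n (sum_n a) n). }
  apply (is_lim_seq_le _ _ (Rabs (sum_n (fun k => g k x) n - Sg)) (SM - sum_n M n) H).
  - apply (is_lim_seq_abs _ (sum_n (fun k => g k x) n - Sg)).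
    apply is_lim_seq_minus'; [apply is_lim_seq_const|now apply Hshift].
  - apply is_lim_seq_minus'; [now apply Hshift|apply is_lim_seq_const].
Qed.

Lemma is_derive_Series (f df : nat -> R -> R) (M : nat -> R) (lo x : R) :
  (forall n z, lo < z -> is_derive (f n) z (df n z)) ->
  (forall n z, lo < z -> continuous (df n) z) ->
  (forall n z, lo < z -> Rabs (f n z) <= M n) ->
  (forall n z, lo < z -> Rabs (df n z) <= M n) ->
  ex_series M -> lo < x ->
  is_derive (fun z => Series (fun n => f n z)) x (Series (fun n => df n x)).
Proof.
  intros Hd Hc Hf Hdf HM Hx. set (D := fun z : R => lo < z).
  assert (Hs : forall n z, D z -> is_derive (fun z => sum_n (fun k => f k z) n) z (sum_n (fun k => df k z) n)).
  { intros n z Hz. apply (is_derive_sum_n f n z (fun k => df k z)). intros k _; now apply Hd. }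
  assert (HD : open D) by apply open_gt.
  pose proof (CVU_Derive (fun n z => sum_n (fun k => f k z) n) D) as H.
  replace (Series (fun n => df n x)) with
    (real (Lim_seq (fun n => Derive (fun z => sum_n (fun k => f k z) n) x))).
  2:{ unfold Series. f_equal. apply Lim_seq_ext. intros n. now apply is_derive_unique, Hs. }
  apply H; auto.
  - intros u v z Hu Hv Hz. unfold D in *; lra.
  - now apply CVU_dom_dominated with M.
  - intros n z Hz. eexists; now apply Hs.
  - intros n z Hz. apply continuity_pt_filterlim.
    apply (continuous_ext_loc _ (fun z => sum_n (fun k => df k z) n) z).
    + apply (filter_imp D); [|now apply HD].
      intros w Hw; symmetry; now apply is_derive_unique, Hs.
    + induction n as [|n IH].
      * apply (continuous_ext (df 0%nat)); [intros; now rewrite sum_O|now apply Hc].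
      * apply (continuous_ext (fun z => plus (sum_n (fun k => df k z) n) (df (S n) z))).
        { intros; now rewrite sum_Sn. }
        apply (continuous_plus (fun z => sum_n (fun k => df k z) n)); [exact IH|now apply Hc].
  - intros eps. destruct (CVU_dom_dominated df M D Hdf HM eps) as [N HN].
    exists N; intros n Hn z Hz. specialize (HN n Hn z Hz).
    assert (E : forall k, Derive (fun z => sum_n (fun k => f k z) k) z = sum_n (fun k => df k z) k).
    { intros k; now apply is_derive_unique, Hs. }
    rewrite E, (Lim_seq_ext _ _ E); exact HN.
Qed.

(** * The Lambert series *)

Definition oddR (n : nat) : R := 2 * INR n + 1.

Lemma oddR_ge_1 n : 1 <= oddR n.
Proof. unfold oddR; generalize (pos_INR n); lra. Qed.

Lemma oddR_S n : oddR (S n) = oddR n + 2.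
Proof. unfold oddR; rewrite S_INR; ring. Qed.

Lemma cube_le_exp u : 0 <= u -> u ^ 3 <= 27 * exp u.
Proof.
  intros Hu. replace (exp u) with (exp (u / 3) ^ 3).
  2:{ rewrite <- exp_mult_INR; f_equal; simpl; field. }
  replace 27 with (3 ^ 3) by ring. rewrite <- Rpow_mult_distr.
  apply pow_incr; split; auto. generalize (exp_ineq1_le (u / 3)); lra.
Qed.

Lemma exp_odd x n : exp (- (oddR n * x)) = exp (- x) * exp (- (2 * x)) ^ n.
Proof.
  rewrite <- exp_mult_INR, <- exp_plus. f_equal; unfold oddR; ring.
Qed.

(** By [cube_le_exp] half of the exponential absorbs the cube, and the other half
    leaves a geometric series. *)
Lemma ex_series_odd_cube_exp x : 0 < x ->
  ex_series (fun n => oddR n ^ 3 * exp (- (oddR n * x))).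
Proof.
  intros Hx.
  apply ex_series_dominated with (fun n => (216 / x ^ 3 * exp (- (x / 2))) * exp (- (2 * (x / 2))) ^ n).
  - intros n. pose proof (oddR_ge_1 n) as Ho. pose proof (exp_pos (- (oddR n * x))).
    assert (0 < x ^ 3) by now apply pow_lt.
    rewrite Rabs_pos_eq by (apply Rmult_le_pos; [apply pow_le|]; lra).
    rewrite Rmult_assoc, <- exp_odd.
    pose proof (cube_le_exp (oddR n * (x / 2)) ltac:(nra)) as H1.
    replace (exp (- (oddR n * x))) with (exp (- (oddR n * (x / 2))) * / exp (oddR n * (x / 2))).
    2:{ rewrite <- exp_Ropp, <- exp_plus; f_equal; field. }
    assert (H2 : oddR n ^ 3 <= 216 / x ^ 3 * exp (oddR n * (x / 2))).
    { apply Rmult_le_reg_r with (x ^ 3 / 8); [lra|].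
      replace (oddR n ^ 3 * (x ^ 3 / 8)) with ((oddR n * (x / 2)) ^ 3) by field.
      eapply Rle_trans; [exact H1|]. apply Req_le; field; lra. }
    pose proof (exp_pos (oddR n * (x / 2))). pose proof (exp_pos (- (oddR n * (x / 2)))).
    apply Rmult_le_reg_r with (exp (oddR n * (x / 2))); auto.
    replace (oddR n ^ 3 * _ * _) with (oddR n ^ 3 * exp (- (oddR n * (x / 2)))) by (field; lra).
    replace (216 / x ^ 3 * _ * _) with (216 / x ^ 3 * exp (oddR n * (x / 2)) * exp (- (oddR n * (x / 2)))) by ring.
    apply Rmult_le_compat_r; lra.
  - eexists. apply series_geom_exp. lra.
Qed.

Lemma ex_series_odd_pow_exp x k : 0 < x -> (k <= 3)%nat ->
  ex_series (fun n => oddR n ^ k * exp (- (oddR n * x))).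
Proof.
  intros Hx Hk. apply ex_series_dominated with (2 := ex_series_odd_cube_exp x Hx).
  intros n. pose proof (oddR_ge_1 n). pose proof (exp_pos (- (oddR n * x))).
  rewrite Rabs_pos_eq by (apply Rmult_le_pos; [apply pow_le|]; lra).
  apply Rmult_le_compat_r; [lra|]. now apply Rle_pow.
Qed.

Lemma is_series_shift_eq (a b : nat -> R) (l k : R) :
  is_series a l -> is_series b k -> (forall n, a (S n) = b n) -> l = a 0%nat + k.
Proof.
  intros Ha Hb E. apply series_incr_1 in Ha.
  rewrite <- (is_series_unique _ _ Hb).
  rewrite (Series_ext b (fun n => a (S n))) by auto.
  rewrite (is_series_unique _ _ Ha). ring.
Qed.

Lemma sech_as_exp x : sech x = 2 * exp (- x) / (1 + exp (- x) ^ 2).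
Proof.
  unfold sech, cosh. rewrite exp_Ropp. pose proof (exp_pos x). field; nra.
Qed.

(** The sums of (-1)^n (2n+1)^j z^(2n+1) for j = 0, 1, 2 satisfy a triangular
    linear system, obtained by shifting n by one. *)
Lemma series_odd_sq_exp x : 0 < x ->
  is_series (fun n => (-1) ^ n * oddR n ^ 2 * exp (- (oddR n * x)))
    ((sech x - 2 * sech x ^ 3) / 2).
Proof.
  intros Hx. set (z := exp (- x)).
  assert (Hz : 0 < z) by apply exp_pos.
  assert (Hex : forall k, (k <= 3)%nat -> exists s : R,
    is_series (fun n => (-1) ^ n * oddR n ^ k * exp (- (oddR n * x))) s).
  { intros k Hk. cut (ex_series (fun n => (-1) ^ n * oddR n ^ k * exp (- (oddR n * x)))); [auto|].
    apply ex_series_dominated with (2 := ex_series_odd_pow_exp x k Hx Hk).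
    intros n. pose proof (oddR_ge_1 n). pose proof (exp_pos (- (oddR n * x))).
    rewrite !Rabs_mult, pow_1_abs, !Rabs_pos_eq by (try apply pow_le; lra). lra. }
  destruct (Hex 0%nat ltac:(lia)) as [S0 H0]. destruct (Hex 1%nat ltac:(lia)) as [S1 H1].
  destruct (Hex 2%nat ltac:(lia)) as [S2 H2].
  assert (Hexp : forall n, exp (- (oddR (S n) * x)) = z ^ 2 * exp (- (oddR n * x))).
  { intros n; rewrite oddR_S. replace (- ((oddR n + 2) * x)) with (INR 2 * - x + - (oddR n * x)) by (simpl; ring).
    now rewrite exp_plus, exp_mult_INR. }
  assert (Hexp0 : exp (- (oddR 0 * x)) = z) by (unfold oddR, z; f_equal; simpl; ring).
  assert (E0 : S0 = z + - z ^ 2 * S0).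
  { rewrite (is_series_shift_eq _ _ _ _ H0 (series_scal (- z ^ 2) _ _ H0)) at 1.
    - rewrite Hexp0; simpl; ring.
    - intros n; cbv beta; rewrite Hexp; simpl; ring. }
  assert (E1 : S1 = z + - z ^ 2 * (S1 + 2 * S0)).
  { rewrite (is_series_shift_eq _ _ _ _ H1 (series_scal (- z ^ 2) _ _ (series_plus _ _ _ _ H1 (series_scal 2 _ _ H0)))) at 1.
    - rewrite Hexp0; unfold oddR; simpl; ring.
    - intros n; cbv beta; rewrite Hexp, oddR_S; simpl; ring. }
  assert (E2 : S2 = z + - z ^ 2 * (S2 + (4 * S1 + 4 * S0))).
  { rewrite (is_series_shift_eq _ _ _ _ H2 (series_scal (- z ^ 2) _ _ (series_plus _ _ _ _ H2
       (series_plus _ _ _ _ (series_scal 4 _ _ H1) (series_scal 4 _ _ H0))))) at 1.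
    - rewrite Hexp0; unfold oddR; simpl; ring.
    - intros n; cbv beta; rewrite Hexp, oddR_S; simpl; ring. }
  replace (_ / 2) with S2; [exact H2|].
  assert (Hw : 0 < 1 + z ^ 2) by nra.
  assert (F0 : S0 = z / (1 + z ^ 2)).
  { apply Rmult_eq_reg_r with (1 + z ^ 2); [|lra]. field_simplify; [|lra]. lra. }
  assert (F1 : S1 = (z - 2 * z ^ 2 * S0) / (1 + z ^ 2)).
  { apply Rmult_eq_reg_r with (1 + z ^ 2); [|lra]. field_simplify; [|lra]. lra. }
  assert (F2 : S2 = (z - 4 * z ^ 2 * (S1 + S0)) / (1 + z ^ 2)).
  { apply Rmult_eq_reg_r with (1 + z ^ 2); [|lra]. field_simplify; [|lra]. lra. }
  rewrite F2, F1, F0, sech_as_exp. fold z. field. lra.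
Qed.

Definition lambert_term (n : nat) (y : R) : R := (-1) ^ n * oddR n ^ 2 / (exp (oddR n * y) - 1).

Lemma exp_odd_gt n y : 0 < y -> 0 < 1 - exp (- y) <= 1 - exp (- (oddR n * y)).
Proof.
  intros Hy. pose proof (exp_neg_lt_1 y Hy). pose proof (oddR_ge_1 n).
  split; [lra|]. assert (exp (- (oddR n * y)) <= exp (- y)); [|lra].
  destruct (Req_dec (oddR n * y) y) as [->|N]; [lra|].
  apply Rlt_le, exp_increasing; nra.
Qed.

Lemma lambert_term_alt n y : 0 < y -> lambert_term n y =
  (-1) ^ n * oddR n ^ 2 * exp (- (oddR n * y)) / (1 - exp (- (oddR n * y))).
Proof.
  intros Hy. pose proof (exp_odd_gt n y Hy). unfold lambert_term.
  rewrite (exp_Ropp (oddR n * y)) in *. pose proof (exp_pos (oddR n * y)).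
  assert (exp (oddR n * y) <> 1).
  { intros E; rewrite E, Rinv_1 in H; lra. }
  field. repeat split; lra.
Qed.

Lemma lambert_term_bound n lo y : 0 < lo -> lo < y ->
  Rabs (lambert_term n y) <= oddR n ^ 2 * exp (- (oddR n * lo)) / (1 - exp (- lo)).
Proof.
  intros Hlo Hy. rewrite lambert_term_alt by lra.
  pose proof (exp_odd_gt n y ltac:(lra)) as H1. pose proof (oddR_ge_1 n) as Ho.
  assert (H3 : exp (- y) < exp (- lo)) by (apply exp_increasing; lra).
  assert (H4 : exp (- (oddR n * y)) <= exp (- (oddR n * lo))).
  { apply Rlt_le, exp_increasing; nra. }
  pose proof (exp_pos (- (oddR n * y))). pose proof (exp_neg_lt_1 lo Hlo).
  unfold Rdiv; rewrite !Rabs_mult, pow_1_abs, Rabs_inv, !Rabs_pos_eq by (try apply pow_le; lra).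
  rewrite Rmult_1_l. apply Rmult_le_compat.
  - apply Rmult_le_pos; [apply pow_le|]; lra.
  - apply Rlt_le, Rinv_0_lt_compat; lra.
  - apply Rmult_le_compat_l; [apply pow_le|]; lra.
  - apply Rinv_le_contravar; lra.
Qed.

(** Expand 1 / (exp ((2n+1) y) - 1) as a geometric series and exchange: for
    fixed m the sum over n is - (2 sech^3 - sech) (m y) / 2, and the points m y
    and - m y contribute equally. *)
Lemma lambert_series_theta y : 0 < y ->
  theta_a y * (theta_a y ^ 2 - theta_c y ^ 2) = 1 - 4 * Series (fun n => lambert_term n y).
Proof.
  intros Hy.
  set (u := fun n m : nat => (-1) ^ n * oddR n ^ 2 * exp (- (oddR n * (INR (S m) * y)))).
  assert (Hu : forall n m, u n m = (-1) ^ n * oddR n ^ 2 * exp (- (oddR n * y)) * exp (- (oddR n * y)) ^ m).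
  { intros n m; unfold u.
    replace (- (oddR n * (INR (S m) * y))) with (- (oddR n * y) + INR m * - (oddR n * y))
      by (rewrite S_INR; ring).
    rewrite exp_plus, exp_mult_INR; ring. }
  assert (Hrow : forall n, is_series (u n) (lambert_term n y)).
  { intros n. rewrite lambert_term_alt by auto. pose proof (oddR_ge_1 n).
    apply is_series_ext with (2 := series_geom_exp (oddR n * y) ((-1) ^ n * oddR n ^ 2 * exp (- (oddR n * y))) ltac:(nra)).
    intros m; now rewrite Hu. }
  assert (Habs : forall n, is_series (fun m => Rabs (u n m)) (Rabs (lambert_term n y))).
  { intros n. replace (Rabs (lambert_term n y)) with ((-1) ^ n * lambert_term n y).
    - apply is_series_ext with (2 := series_scal ((-1) ^ n) _ _ (Hrow n)).
      intros m; unfold u. rewrite !Rabs_mult, pow_1_abs.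
      rewrite !Rabs_pos_eq by (try apply pow_le; try apply Rlt_le, exp_pos; generalize (oddR_ge_1 n); lra).
      rewrite <- !Rmult_assoc, <- Rpow_mult_distr. replace (-1 * -1) with 1 by ring. now rewrite pow1.
    - rewrite lambert_term_alt by auto. pose proof (exp_odd_gt n y Hy).
      unfold Rdiv. rewrite !Rabs_mult, pow_1_abs, Rabs_inv.
      rewrite !Rabs_pos_eq by (try apply pow_le; try apply Rlt_le, exp_pos; generalize (oddR_ge_1 n); lra).
      rewrite <- !Rmult_assoc, <- Rpow_mult_distr. replace (-1 * -1) with 1 by ring. now rewrite pow1. }
  assert (Hex : ex_series (fun n => Rabs (lambert_term n y))).
  { apply ex_series_dominated with (fun n => / (1 - exp (- (y / 2))) * (oddR n ^ 2 * exp (- (oddR n * (y / 2))))).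
    - intros n; rewrite Rabs_Rabsolu. rewrite Rmult_comm. apply lambert_term_bound; lra.
    - destruct (ex_series_odd_pow_exp (y / 2) 2 ltac:(lra) ltac:(lia)) as [l Hl].
      eexists; apply series_scal, Hl. }
  assert (Hlam : ex_series (fun n => lambert_term n y)) by now apply ex_series_Rabs.
  destruct (fubini u _ _ _ Habs Hex Hrow (Series_correct _ Hlam)) as [c [Hc HS]].
  set (L := Series _) in *.
  set (cubic := fun x => 2 * sech x ^ 3 - sech x).
  assert (Hcub : is_series (fun m => cubic (INR (S m) * y)) (-2 * L)).
  { apply is_series_ext with (2 := series_scal (-2) _ _ HS).
    intros m. assert (0 < INR (S m)) by apply lt_0_INR, Nat.lt_0_succ.
    replace (c m) with ((sech (INR (S m) * y) - 2 * sech (INR (S m) * y) ^ 3) / 2).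
    - unfold cubic. match goal with |- @eq _ ?l ?r => change (@eq R l r) end. field.
    - rewrite <- (is_series_unique _ _ (Hc m)). symmetry; apply is_series_unique.
      apply series_odd_sq_exp. nra. }
  refine (is_zsum_eq _ _ _ (lattice_sum_cubic y Hy) _).
  exists (1 + -2 * L), (-2 * L); repeat split; [| |ring].
  - assert (H1 : is_series (fun m => cubic (IZR (Z.of_nat (S m)) * y)) (-2 * L)).
    { apply is_series_ext with (2 := Hcub). intros m; now rewrite INR_IZR_INZ. }
    apply (series_decr_1 (fun m => cubic (IZR (Z.of_nat m) * y))) in H1.
    replace 1 with (cubic (IZR (Z.of_nat 0) * y)); [exact H1|].
    unfold cubic; simpl Z.of_nat; rewrite Rmult_0_l, sech_0; ring.
  - apply is_series_ext with (2 := Hcub). intros m; unfold cubic.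
    replace (IZR (- Z.of_nat m - 1) * y) with (- (INR (S m) * y)).
    + now rewrite sech_opp.
    + rewrite minus_IZR, opp_IZR, <- INR_IZR_INZ, S_INR; ring.
Qed.

Definition csch_term (n : nat) (y : R) : R := (-1) ^ n * oddR n ^ 3 * csch (oddR n / 2 * y) ^ 2.

Lemma csch_half_sq x : 0 < x -> csch (x / 2) ^ 2 = 4 * exp x / (exp x - 1) ^ 2.
Proof.
  intros Hx. unfold csch, sinh. rewrite exp_Ropp.
  assert (E : exp x = exp (x / 2) ^ 2) by (rewrite <- exp_mult_INR; f_equal; simpl; field).
  rewrite E. assert (1 < exp (x / 2)) by (rewrite <- exp_0; apply exp_increasing; lra).
  field. split; nra.
Qed.

Lemma csch_term_alt n y : 0 < y -> csch_term n y =
  4 * ((-1) ^ n * oddR n ^ 3 * exp (oddR n * y) / (exp (oddR n * y) - 1) ^ 2).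
Proof.
  intros Hy; unfold csch_term. replace (oddR n / 2 * y) with (oddR n * y / 2) by field.
  rewrite csch_half_sq by (generalize (oddR_ge_1 n); nra). unfold Rdiv; ring.
Qed.

Lemma csch_term_bound n lo y : 0 < lo -> lo < y ->
  Rabs (csch_term n y) <= 4 * (oddR n ^ 3 * exp (- (oddR n * lo)) / (1 - exp (- lo)) ^ 2).
Proof.
  intros Hlo Hy. rewrite csch_term_alt by lra.
  pose proof (exp_odd_gt n y ltac:(lra)) as H1. pose proof (oddR_ge_1 n) as Ho.
  assert (H3 : exp (- y) < exp (- lo)) by (apply exp_increasing; lra).
  assert (H4 : exp (- (oddR n * y)) <= exp (- (oddR n * lo))).
  { apply Rlt_le, exp_increasing; nra. }
  pose proof (exp_pos (- (oddR n * y))) as H5. pose proof (exp_neg_lt_1 lo Hlo).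
  assert (Hq : exp (oddR n * y) / (exp (oddR n * y) - 1) ^ 2
    = exp (- (oddR n * y)) * / (1 - exp (- (oddR n * y))) ^ 2).
  { rewrite (exp_Ropp (oddR n * y)) in *. pose proof (exp_pos (oddR n * y)).
    assert (exp (oddR n * y) <> 1).
    { intros E; rewrite E, Rinv_1 in H1; lra. }
    field. repeat split; lra. }
  unfold Rdiv in *. rewrite (Rmult_assoc _ (exp _)), Hq.
  rewrite !Rabs_mult, pow_1_abs, Rabs_inv.
  rewrite !Rabs_pos_eq by (try apply pow_le; lra).
  apply Rmult_le_compat_l; [lra|].
  rewrite Rmult_1_l, Rmult_assoc.
  apply Rmult_le_compat_l; [apply pow_le; lra|]. apply Rmult_le_compat.
  - lra.
  - apply Rlt_le, Rinv_0_lt_compat, pow_lt; lra.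
  - lra.
  - apply Rinv_le_contravar; [apply pow_lt; lra|apply pow_incr; lra].
Qed.

Lemma is_derive_lambert_series y : 0 < y ->
  is_derive (fun y => Series (fun n => lambert_term n y)) y
    (- / 4 * Series (fun n => csch_term n y)).
Proof.
  intros Hy. set (lo := y / 2). assert (Hlo : 0 < lo) by (unfold lo; lra).
  pose proof (exp_neg_lt_1 lo Hlo) as He. pose proof (exp_pos (- lo)).
  set (K := / (1 - exp (- lo)) ^ 2).
  assert (HK : / (1 - exp (- lo)) <= K).
  { apply Rinv_le_contravar; [apply pow_lt; lra|nra]. }
  rewrite <- Series_scal_l.
  apply (is_derive_Series lambert_term (fun n y => - / 4 * csch_term n y)
    (fun n => K * (oddR n ^ 3 * exp (- (oddR n * lo)))) lo); [| | | | |unfold lo; lra].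
  - intros n z Hz. rewrite csch_term_alt by lra. pose proof (oddR_ge_1 n).
    assert (1 < exp (oddR n * z)) by (rewrite <- exp_0; apply exp_increasing; nra).
    unfold lambert_term. auto_derive; [lra|]. field; lra.
  - intros n z Hz. pose proof (oddR_ge_1 n).
    assert (Hs : 0 < sinh (oddR n / 2 * z)) by (apply sinh_pos; nra).
    unfold csch_term, csch. unfold sinh in *.
    apply (ex_derive_continuous (fun z => - / 4 * ((-1) ^ n * oddR n ^ 3 * (1 / ((exp (oddR n / 2 * z) - exp (- (oddR n / 2 * z))) / 2)) ^ 2))).
    auto_derive. lra.
  - intros n z Hz. eapply Rle_trans; [now apply lambert_term_bound with (lo := lo)|].
    pose proof (oddR_ge_1 n). pose proof (exp_pos (- (oddR n * lo))).
    unfold Rdiv; rewrite Rmult_comm. apply Rmult_le_compat; auto.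
    + apply Rlt_le, Rinv_0_lt_compat; lra.
    + apply Rmult_le_pos; [apply pow_le|]; lra.
    + apply Rmult_le_compat_r; [lra|]. apply Rle_pow; auto.
  - intros n z Hz. rewrite Rabs_mult, Rabs_Ropp, Rabs_pos_eq by lra.
    pose proof (csch_term_bound n lo z Hlo Hz) as B. unfold Rdiv in B; fold K in B. lra.
  - destruct (ex_series_odd_cube_exp lo Hlo) as [l Hl]. eexists; apply series_scal, Hl.
Qed.

(** * Complete elliptic integrals as functions of the parameter *)

Definition Delta (m x : R) : R := sqrt (1 - m * sin x ^ 2).
Definition ellK_param (m : R) : R := RInt (fun x => 1 / Delta m x) 0 (PI / 2).
Definition ellE_param (m : R) : R := RInt (Delta m) 0 (PI / 2).

Lemma radicand_pos m x : m < 1 -> 0 < 1 - m * sin x ^ 2.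
Proof.
  intros Hm. pose proof (sin_cos_sq x). pose proof (pow2_ge_0 (cos x)).
  pose proof (pow2_ge_0 (sin x)). destruct (Rle_lt_dec m 0); nra.
Qed.

Lemma Delta_pos m x : m < 1 -> 0 < Delta m x.
Proof. intros; now apply sqrt_lt_R0, radicand_pos. Qed.

Lemma Delta_sq m x : m < 1 -> Delta m x ^ 2 = 1 - m * sin x ^ 2.
Proof. intros; now apply pow2_sqrt, Rlt_le, radicand_pos. Qed.

Lemma is_derive_Delta m x : m < 1 ->
  is_derive (Delta m) x (- m * sin x * cos x / Delta m x).
Proof.
  intros Hm. pose proof (radicand_pos m x Hm) as H.
  pose proof (Delta_pos m x Hm) as Hd. unfold Delta in *. auto_derive.
  - simpl in H; lra.
  - replace (1 + - _) with (1 - m * sin x ^ 2) by (simpl; ring). field. lra.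
Qed.

Lemma continuous_Delta m x : m < 1 -> continuous (Delta m) x.
Proof.
  intros Hm; apply (ex_derive_continuous (Delta m)). eexists; now apply is_derive_Delta.
Qed.

Lemma continuous_inv_Delta m x : m < 1 -> continuous (fun x => 1 / Delta m x) x.
Proof.
  intros Hm; apply (ex_derive_continuous (fun x => 1 / Delta m x)).
  pose proof (Delta_pos m x Hm). auto_derive. split; [|lra].
  eexists; now apply is_derive_Delta.
Qed.

Lemma is_RInt_ellK_param m : m < 1 -> is_RInt (fun x => 1 / Delta m x) 0 (PI / 2) (ellK_param m).
Proof.
  intros Hm. apply (RInt_correct (fun x => 1 / Delta m x)).
  apply (ex_RInt_continuous (fun x => 1 / Delta m x)). intros; now apply continuous_inv_Delta.
Qed.

Lemma is_RInt_ellE_param m : m < 1 -> is_RInt (Delta m) 0 (PI / 2) (ellE_param m).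
Proof.
  intros Hm. apply (RInt_correct (Delta m)).
  apply (ex_RInt_continuous (Delta m)). intros; now apply continuous_Delta.
Qed.

Lemma ellK_param_pos m : m < 1 -> 0 < ellK_param m.
Proof.
  intros Hm; apply RInt_gt_0; [exact PI2_RGT_0| |].
  - intros x _. pose proof (Delta_pos m x Hm). apply Rdiv_lt_0_compat; lra.
  - intros x _; now apply continuous_inv_Delta.
Qed.

Lemma sin_sq_interior x : 0 < x < PI / 2 -> 0 < sin x ^ 2 < 1.
Proof.
  intros Hx. pose proof (sin_cos_sq x).
  assert (0 < sin x) by (apply sin_gt_0; generalize PI_RGT_0; lra).
  assert (0 < cos x) by (apply cos_gt_0; lra). nra.
Qed.

Lemma ellK_param_increasing m n : m < n -> n < 1 -> ellK_param m < ellK_param n.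
Proof.
  intros Hmn Hn. apply RInt_lt; [exact PI2_RGT_0| | |].
  - intros; apply continuous_inv_Delta; lra.
  - intros; apply continuous_inv_Delta; lra.
  - intros x Hx. pose proof (sin_sq_interior x Hx). pose proof (radicand_pos n x Hn).
    assert (Hd : Delta n x < Delta m x) by (apply sqrt_lt_1_alt; nra).
    pose proof (Delta_pos n x Hn). unfold Rdiv; rewrite !Rmult_1_l.
    apply Rinv_lt_contravar; auto. apply Rmult_lt_0_compat; lra.
Qed.

Lemma ellE_param_gt m : 0 < m < 1 -> (1 - m) * ellK_param m < ellE_param m.
Proof.
  intros Hm.
  assert (E : RInt (fun x => (1 - m) * (1 / Delta m x)) 0 (PI / 2) = (1 - m) * ellK_param m)
    by exact (is_RInt_unique _ _ _ _ (is_RInt_scal _ _ _ (1 - m) _ (is_RInt_ellK_param m (proj2 Hm)))).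
  rewrite <- E.
  apply RInt_lt; [exact PI2_RGT_0| | |].
  - intros; apply continuous_Delta; lra.
  - intros; apply (continuous_scal_r (1 - m) (fun x => 1 / Delta m x)). apply continuous_inv_Delta; lra.
  - intros x Hx. pose proof (sin_sq_interior x Hx).
    pose proof (Delta_pos m x (proj2 Hm)). pose proof (Delta_sq m x (proj2 Hm)).
    change ((1 - m) * (1 / Delta m x) < Delta m x).
    apply Rmult_lt_reg_r with (Delta m x); auto. field_simplify; [nra|lra].
Qed.

(** Integration by parts: sin cos / Delta vanishes at both ends, and m times its
    derivative is Delta - (1 - m) / Delta^3. *)
Lemma is_RInt_sin_sq_Delta_cube m : 0 < m < 1 ->
  is_RInt (fun x => sin x ^ 2 / (2 * Delta m x ^ 3)) 0 (PI / 2)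
    ((ellE_param m - (1 - m) * ellK_param m) / (2 * m * (1 - m))).
Proof.
  intros [Hm0 Hm].
  set (f := fun x => sin x * cos x / Delta m x).
  set (df := fun x => (Delta m x - (1 - m) * (1 / Delta m x) * (1 / Delta m x ^ 2)) / m).
  assert (Hf : is_RInt df 0 (PI / 2) (f (PI / 2) - f 0)).
  { apply (is_RInt_derive f df).
    - intros x _. pose proof (Delta_pos m x Hm) as Hp. pose proof (Delta_sq m x Hm) as Hs.
      pose proof (is_derive_Delta m x Hm) as Hd. pose proof (sin_cos_sq x) as Hsc.
      unfold f. auto_derive.
      + repeat split; [now exists (- m * sin x * cos x / Delta m x)|lra].
      + replace (Derive _ x) with (- m * sin x * cos x / Delta m x)
          by (symmetry; now apply is_derive_unique).
        unfold df. set (D := Delta m x) in *.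
        apply Rmult_eq_reg_r with (m * D ^ 3); [|apply Rgt_not_eq, Rmult_lt_0_compat; [lra|now apply pow_lt]].
        field_simplify; [|lra|lra].
        replace (D ^ 4) with ((D ^ 2) ^ 2) by ring. rewrite Hs.
        replace (cos x ^ 2) with (1 - sin x ^ 2) by lra. ring.
    - intros x _. pose proof (Delta_pos m x Hm) as Hp.
      apply (ex_derive_continuous df). unfold df. auto_derive.
      repeat split; try lra; try (eexists; now apply is_derive_Delta).
      apply Rgt_not_eq; simpl; nra. }
  assert (H0 : f (PI / 2) - f 0 = 0).
  { unfold f; rewrite cos_PI2, sin_0. unfold Rdiv; ring. }
  rewrite H0 in Hf.
  pose proof (is_RInt_scal _ _ _ (/ (2 * m * (1 - m))) _ (is_RInt_minus _ _ _ _ _ _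
   (is_RInt_minus _ _ _ _ _ _ (is_RInt_ellE_param m Hm) (is_RInt_scal _ _ _ (1 - m) _ (is_RInt_ellK_param m Hm)))
   (is_RInt_scal _ _ _ m _ Hf))) as H.
  replace ((ellE_param m - (1 - m) * ellK_param m) / (2 * m * (1 - m))) with
    (scal (/ (2 * m * (1 - m))) (minus (minus (ellE_param m) (scal (1 - m) (ellK_param m))) (scal m 0)) : R).
  2:{ change (/ (2 * m * (1 - m)) * (ellE_param m - (1 - m) * ellK_param m - m * 0)
        = (ellE_param m - (1 - m) * ellK_param m) / (2 * m * (1 - m))). field. lra. }
  apply is_RInt_ext with (2 := H). intros x _.
  change (/ (2 * m * (1 - m)) * (Delta m x - (1 - m) * (1 / Delta m x) - m * df x)
    = sin x ^ 2 / (2 * Delta m x ^ 3)).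
  pose proof (Delta_pos m x Hm) as Hp. pose proof (Delta_sq m x Hm) as Hs. unfold df.
  replace (sin x ^ 2) with ((1 - Delta m x ^ 2) / m) by (rewrite Hs; field; lra).
  field. lra.
Qed.

Lemma is_derive_inv_Delta_param x m : m < 1 ->
  is_derive (fun u => 1 / Delta u x) m (sin x ^ 2 / (2 * Delta m x ^ 3)).
Proof.
  intros Hm. pose proof (radicand_pos m x Hm) as H.
  pose proof (Delta_pos m x Hm) as Hd. pose proof (Delta_sq m x Hm) as Hs.
  unfold Delta in *.
  auto_derive; replace (1 + - _) with (1 - m * sin x ^ 2) by (simpl; ring).
  - repeat split; lra.
  - field. lra.
Qed.

Lemma is_derive_ellK_param m : 0 < m < 1 ->
  is_derive ellK_param m ((ellE_param m - (1 - m) * ellK_param m) / (2 * m * (1 - m))).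
Proof.
  intros Hm.
  assert (Hloc : locally m (fun u => u < 1)) by (apply open_lt; lra).
  rewrite <- (is_RInt_unique _ _ _ _ (is_RInt_sin_sq_Delta_cube m Hm)).
  replace (RInt (fun x => sin x ^ 2 / (2 * Delta m x ^ 3)) 0 (PI / 2)) with
    (RInt (fun t => Derive (fun u => 1 / Delta u t) m) 0 (PI / 2)).
  2:{ apply RInt_ext; intros x _. apply is_derive_unique, is_derive_inv_Delta_param; lra. }
  apply (is_derive_RInt_param (fun u t => 1 / Delta u t)).
  - apply filter_imp with (2 := Hloc). intros u Hu t _.
    eexists; now apply is_derive_inv_Delta_param.
  - intros t _.
    apply continuity_2d_pt_ext_loc with (fun u v => sin v ^ 2 * / (2 * sqrt (1 - u * sin v ^ 2) ^ 3)).
    + destruct Hloc as [eps Heps]. exists eps. intros u v Hu _.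
      symmetry; apply is_derive_unique. apply (is_derive_inv_Delta_param v u). now apply Heps.
    + assert (Hsin : continuity_2d_pt (fun _ v => sin v ^ 2) m t).
      { apply (continuity_1d_2d_pt_comp (fun v => sin v ^ 2) (fun _ v => v)).
        - apply continuity_pt_filterlim. apply (ex_derive_continuous (fun v => sin v ^ 2)). auto_derive; auto.
        - apply continuity_2d_pt_id2. }
      apply continuity_2d_pt_mult; [exact Hsin|].
      apply (continuity_1d_2d_pt_comp (fun w => / (2 * sqrt w ^ 3)) (fun u v => 1 - u * sin v ^ 2)).
      * apply continuity_pt_filterlim. pose proof (radicand_pos m t (proj2 Hm)) as H.
        pose proof (sqrt_lt_R0 _ H). set (w := 1 - m * sin t ^ 2) in *.
        apply (ex_derive_continuous (fun w => / (2 * sqrt w ^ 3))). auto_derive.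
        repeat split; auto. apply Rgt_not_eq. simpl; assert (0 < sqrt w * sqrt w) by nra. nra.
      * apply continuity_2d_pt_minus; [apply continuity_2d_pt_const|].
        apply continuity_2d_pt_mult; [apply continuity_2d_pt_id1|exact Hsin].
  - apply filter_imp with (2 := Hloc). intros u Hu. eexists; now apply is_RInt_ellK_param.
Qed.

(** * The nome *)

(** The opposite of the logarithm of the nome. *)
Definition log_nome (m : R) : R := PI * (ellK_param (1 - m) / ellK_param m).
(** The form of Legendre's relation.  The derivative of [log_nome] is a multiple
    of it, whence the denominator of the theorem. *)
Definition legendre_form (m : R) : R := ellK_param (1 - m) * (ellE_param m - ellK_param m) + ellE_param (1 - m) * ellK_param m.

(** The bounds E > (1 - m) K and E' > m K' give
    K'E + E'K > K K' ((1 - m) + m) = K K'. *)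
Lemma legendre_pos m : 0 < m < 1 -> 0 < legendre_form m.
Proof.
  intros Hm. pose proof (ellE_param_gt m Hm) as H1. pose proof (ellE_param_gt (1 - m) ltac:(lra)) as H2.
  replace (1 - (1 - m)) with m in H2 by ring.
  pose proof (ellK_param_pos m ltac:(lra)). pose proof (ellK_param_pos (1 - m) ltac:(lra)).
  unfold legendre_form. nra.
Qed.

Lemma log_nome_pos m : 0 < m < 1 -> 0 < log_nome m.
Proof.
  intros Hm. apply Rmult_lt_0_compat; [apply PI_RGT_0|].
  apply Rdiv_lt_0_compat; apply ellK_param_pos; lra.
Qed.

Lemma log_nome_decreasing m n : 0 < m -> m < n -> n < 1 -> log_nome n < log_nome m.
Proof.
  intros Hm Hmn Hn. apply Rmult_lt_compat_l; [apply PI_RGT_0|].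
  pose proof (ellK_param_pos m ltac:(lra)). pose proof (ellK_param_pos n ltac:(lra)).
  pose proof (ellK_param_pos (1 - n) ltac:(lra)).
  apply Rmult_gt_0_lt_compat; auto.
  - now apply Rinv_0_lt_compat.
  - apply ellK_param_pos; lra.
  - apply ellK_param_increasing; lra.
  - apply Rinv_lt_contravar; [now apply Rmult_lt_0_compat|]. apply ellK_param_increasing; lra.
Qed.

Lemma is_derive_log_nome m : 0 < m < 1 ->
  is_derive log_nome m (- PI * legendre_form m / (2 * m * (1 - m) * ellK_param m ^ 2)).
Proof.
  intros Hm. pose proof (is_derive_ellK_param m Hm) as H1.
  pose proof (is_derive_ellK_param (1 - m) ltac:(lra)) as H2.
  pose proof (ellK_param_pos m ltac:(lra)). pose proof (ellK_param_pos (1 - m) ltac:(lra)).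
  unfold log_nome. auto_derive.
  - repeat split; [now exists ((ellE_param (1 - m) - (1 - (1 - m)) * ellK_param (1 - m)) / (2 * (1 - m) * (1 - (1 - m))))|
      now exists ((ellE_param m - (1 - m) * ellK_param m) / (2 * m * (1 - m)))|lra].
  - replace (Derive _ m) with ((ellE_param m - (1 - m) * ellK_param m) / (2 * m * (1 - m)))
      by (symmetry; now apply is_derive_unique).
    replace (Derive _ (1 + - m)) with ((ellE_param (1 - m) - (1 - (1 - m)) * ellK_param (1 - m)) / (2 * (1 - m) * (1 - (1 - m))))
      by (symmetry; now apply is_derive_unique).
    replace (1 + - m) with (1 - m) by ring. unfold legendre_form. field. lra.
Qed.

(** * Theta constants as elliptic integrals *)

Lemma ellK_param_gauss_int a b c : 0 < a -> 0 < b -> b ^ 2 = a ^ 2 - c ^ 2 ->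
  ellK_param ((c / a) ^ 2) = a * gauss_int a b.
Proof.
  intros Ha Hb E. unfold gauss_int.
  rewrite <- (RInt_scal (V := R_CompleteNormedModule) (gauss_integrand a b)) by now apply ex_RInt_gauss.
  apply RInt_ext; intros x _.
  change (1 / Delta ((c / a) ^ 2) x = a * gauss_integrand a b x).
  unfold Delta, gauss_integrand. pose proof (sin_cos_sq x).
  replace (a ^ 2 * cos x ^ 2 + b ^ 2 * sin x ^ 2) with (a ^ 2 * (1 - (c / a) ^ 2 * sin x ^ 2)).
  - rewrite sqrt_mult_alt by apply pow2_ge_0. rewrite sqrt_pow2 by lra.
    rewrite Rinv_mult, <- Rmult_assoc, Rinv_r by lra. reflexivity.
  - rewrite E. replace (cos x ^ 2) with (1 - sin x ^ 2) by lra. field. lra.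
Qed.

Definition modulus_sq (y : R) : R := (theta_c y / theta_a y) ^ 2.

Lemma modulus_sq_range y : 0 < y -> 0 < modulus_sq y < 1.
Proof.
  intros Hy. pose proof (theta_c_pos y Hy). pose proof (theta_c_lt_a y Hy).
  assert (0 < theta_c y / theta_a y) by (apply Rdiv_lt_0_compat; lra).
  assert (theta_c y / theta_a y < 1) by (apply Rmult_lt_reg_r with (theta_a y); [lra|]; field_simplify; lra).
  unfold modulus_sq; nra.
Qed.

Lemma ellK_param_modulus_sq y : 0 < y -> ellK_param (modulus_sq y) = theta_a y * (PI / 2).
Proof.
  intros Hy. rewrite <- (gauss_int_theta_ab y Hy).
  apply ellK_param_gauss_int; [now apply theta_a_pos|now apply theta_b_pos|now apply theta_b_sq].
Qed.

Lemma ellK_param_compl_modulus_sq y : 0 < y -> ellK_param (1 - modulus_sq y) = theta_a y * (y / 2).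
Proof.
  intros Hy. pose proof (theta_a_pos y Hy). rewrite <- (gauss_int_theta_ac y Hy).
  pose proof (theta_b_sq y Hy) as E.
  replace (1 - modulus_sq y) with ((theta_b y / theta_a y) ^ 2).
  - apply ellK_param_gauss_int; [lra|now apply theta_c_pos|lra].
  - unfold modulus_sq, Rdiv; rewrite !Rpow_mult_distr, E. field. lra.
Qed.

Lemma log_nome_modulus_sq y : 0 < y -> log_nome (modulus_sq y) = y.
Proof.
  intros Hy. unfold log_nome. rewrite ellK_param_modulus_sq, ellK_param_compl_modulus_sq by auto.
  pose proof (theta_a_pos y Hy). pose proof PI_RGT_0. field. lra.
Qed.

(** [log_nome] is injective and [modulus_sq] is a right inverse of it. *)
Lemma modulus_sq_log_nome m : 0 < m < 1 -> modulus_sq (log_nome m) = m.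
Proof.
  intros Hm. pose proof (log_nome_pos m Hm) as Hy.
  pose proof (log_nome_modulus_sq _ Hy) as E. pose proof (modulus_sq_range _ Hy) as Hr.
  set (n := modulus_sq _) in *.
  destruct (Rtotal_order n m) as [H|[H|H]]; auto.
  - pose proof (log_nome_decreasing n m); lra.
  - pose proof (log_nome_decreasing m n); lra.
Qed.

(** * The series *)

Lemma lambert_series_elliptic m : 0 < m < 1 ->
  1 - 4 * Series (fun n => lambert_term n (log_nome m)) = (2 / PI * ellK_param m) ^ 3 * (1 - m).
Proof.
  intros Hm. pose proof (log_nome_pos m Hm) as Hy. pose proof PI_RGT_0.
  rewrite <- lambert_series_theta by auto.
  pose proof (theta_a_pos _ Hy).
  pose proof (ellK_param_modulus_sq _ Hy) as HK. pose proof (modulus_sq_log_nome m Hm) as E.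
  rewrite E in HK. unfold modulus_sq in E. set (y := log_nome m) in *.
  rewrite HK, <- E. field. lra.
Qed.

Theorem theorem2 :
  forall k : R, 0 < k ^ 2 < 1 ->
  let K := ellK k in
  let E := ellE k in
  let K' := ellK (compl_modulus k) in
  let E' := ellE (compl_modulus k) in
  let a := fun n : nat =>
    (-1) ^ n * (2 * INR n + 1) ^ 3
      * csch ((2 * INR n + 1) / 2 * (K' / K) * PI) ^ 2 in
  ex_series a ->
  Series a =
    8 * (k ^ 2 - 1) * K ^ 4 * (3 * E + (k ^ 2 - 3) * K)
      / (PI ^ 4 * (K' * (E - K) + E' * K)).
Proof.
  intros k Hk K E K' E' a _.
  set (m := k ^ 2) in *.
  assert (Hk' : compl_modulus k ^ 2 = 1 - m).
  { unfold compl_modulus; fold m. apply pow2_sqrt; lra. }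
  assert (EK : K = ellK_param m) by reflexivity. assert (EE : E = ellE_param m) by reflexivity.
  assert (EK' : K' = ellK_param (1 - m)) by (rewrite <- Hk'; reflexivity).
  assert (EE' : E' = ellE_param (1 - m)) by (rewrite <- Hk'; reflexivity).
  assert (Ea : Series a = Series (fun n => csch_term n (log_nome m))).
  { apply Series_ext; intros n. unfold a, csch_term, oddR, log_nome.
    rewrite EK, EK'. do 3 f_equal. unfold Rdiv; ring. }
  rewrite Ea. set (S := Series _).
  pose proof (ellK_param_pos m ltac:(lra)) as HK. pose proof (legendre_pos m Hk) as HW.
  pose proof PI_RGT_0 as Hpi.
  assert (D1 : is_derive (fun m => 1 - 4 * Series (fun n => lambert_term n (log_nome m))) m
    (S * (- PI * legendre_form m / (2 * m * (1 - m) * ellK_param m ^ 2)))).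
  { pose proof (is_derive_comp _ _ _ _ _ (is_derive_lambert_series _ (log_nome_pos m Hk))
      (is_derive_log_nome m Hk)) as H.
    apply (is_derive_scal _ _ 4) in H.
    pose proof (is_derive_minus (fun _ => 1) _ m 0 _ (is_derive_const 1 m) H) as H'.
    fold S in H'.
    replace (S * _) with (minus 0 (4 * scal (- PI * legendre_form m / (2 * m * (1 - m) * ellK_param m ^ 2)) (- / 4 * S))).
    - exact H'.
    - change (0 - 4 * ((- PI * legendre_form m / (2 * m * (1 - m) * ellK_param m ^ 2)) * (- / 4 * S))
        = S * (- PI * legendre_form m / (2 * m * (1 - m) * ellK_param m ^ 2))). field. lra. }
  assert (D2 : is_derive (fun m => (2 / PI * ellK_param m) ^ 3 * (1 - m)) m
    (8 * ellK_param m ^ 2 * (3 * ellE_param m + (m - 3) * ellK_param m) / (2 * m * PI ^ 3))).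
  { pose proof (is_derive_ellK_param m Hk) as H. auto_derive.
    - repeat split. eexists; exact H.
    - replace (Derive _ m) with ((ellE_param m - (1 - m) * ellK_param m) / (2 * m * (1 - m)))
        by (symmetry; now apply is_derive_unique).
      field. lra. }
  assert (D : S * (- PI * legendre_form m / (2 * m * (1 - m) * ellK_param m ^ 2))
    = 8 * ellK_param m ^ 2 * (3 * ellE_param m + (m - 3) * ellK_param m) / (2 * m * PI ^ 3)).
  { rewrite <- (is_derive_unique _ _ _ D1), <- (is_derive_unique _ _ _ D2).
    apply Derive_ext_loc.
    assert (Hloc : locally m (fun u => 0 < u < 1)).
    { apply (open_and (fun u => 0 < u) (fun u => u < 1)); [apply open_gt|apply open_lt|exact Hk]. }
    apply filter_imp with (2 := Hloc). intros u Hu; now apply lambert_series_elliptic. }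
  rewrite EK, EE, EK', EE'. fold (legendre_form m).
  apply Rmult_eq_reg_r with (- PI * legendre_form m / (2 * m * (1 - m) * ellK_param m ^ 2)).
  - rewrite D. field. repeat split; lra.
  - apply Rlt_not_eq. unfold Rdiv. rewrite <- !Ropp_mult_distr_l.
    apply Ropp_lt_gt_0_contravar, Rmult_lt_0_compat; [nra|].
    apply Rinv_0_lt_compat, Rmult_lt_0_compat; [nra|now apply pow_lt].
Qed.
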